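(* Let $m<n$ be two positive integers and let $(Y_{1,1},\ldots,Y_{m,n})$ be a uniform random variable on the set $\mathcal{Y}_{m,n}$. (i) Let $k\in[1,m]$ be an integer. Then the $k$-tuple $$(Y_{1,n-k+1},Y_{2,n-k+2},\ldots,Y_{k-1,n-1},Y_{k,n})$$ has a marginal density on $[0,1]^k$ proportional to $$\mathbf{1}_{\{x_1\leq x_2\leq\cdots\leq x_k\}}\,\Delta(x_1,\ldots,x_k)^2\prod_{i=1}^k x_i^{n-k}(1-x_i)^{m-k}.$$ (ii) Let $k$ be an integer with $m<k\leq n$. Then the $m$-tuple $$(Y_{1,n-k+1},Y_{2,n-k+2},\ldots,Y_{m-1,n-k+m-1},Y_{m,n-k+m})$$ has a marginal density on $[0,1]^m$ proportional to $$\mathbf{1}_{\{x_1\leq x_2\leq\cdots\leq x_m\}}\,\Delta(x_1,\ldots,x_m)^2\prod_{i=1}^m x_i^{n-k}(1-x_i)^{k-m}.$$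
   Context: For positive integers $m,n$, $\mathcal{Y}_{m,n}$ is the set of $mn$-tuples $(Y_{i,j})_{1\le i\le m,\,1\le j\le n}$ of reals in $[0,1]$ satisfying, for all $i,j$, $Y_{i,j}<\min(Y_{i,j+1},Y_{i+1,j})$ (inequalities involving indices outside the rectangle are omitted). A uniform random variable on $\mathcal{Y}_{m,n}$ is one distributed according to normalized Lebesgue measure of $\mathbb{R}^{mn}$ restricted to $\mathcal{Y}_{m,n}$. The Vandermonde is $\Delta(x_1,\ldots,x_k)=\prod_{1\le i<j\le k}(x_i-x_j)$ (equal to $1$ for $k=1$). Densities are with respect to Lebesgue measure. *)

(* Defs.v *)
From HB Require Import structures.
From mathcomp Require Import all_boot all_order all_algebra.
From mathcomp Require Import all_classical all_reals all_analysis.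

Set Implicit Arguments.
Unset Strict Implicit.
Unset Printing Implicit Defensive.

Import Order.TTheory GRing.Theory Num.Theory.
Import numFieldNormedType.Exports.

Local Open Scope classical_set_scope.
Local Open Scope ring_scope.

Definition cons_pair (R : realType) n (x : measurableTypeR R * n.-tuple R)
  : n.+1.-tuple R :=
  [tuple of x.1 :: x.2].

(* Lebesgue measure on R^n, on the product sigma-algebra of [n.-tuple R]:
   the n-fold product of the one-dimensional Lebesgue measure. *)
Fixpoint lebesgue_tuple (R : realType) (n : nat) : set (n.-tuple R) -> \bar R :=
  match n with
  | 0 => \d_([tuple] : 0.-tuple R)
  | n'.+1 => pushforward (lebesgue_measure \x @lebesgue_tuple R n')%E
               (@cons_pair R n')
  end.

Section lebesgue_tuple_step.
Context (R : realType) (n : nat).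
Variable mu : {sigma_finite_measure set (n.-tuple R) -> \bar R}.

Let nu := pushforward (lebesgue_measure \x mu)%E (@cons_pair R n).

Lemma measurable_cons_pair : measurable_fun setT (@cons_pair R n).
Proof. exact: measurable_cons. Qed.

Let mcons A : measurable A -> measurable (@cons_pair R n @^-1` A).
Proof.
by move=> mA; rewrite -[X in measurable X]setTI; exact: measurable_cons_pair.
Qed.

Let nu0 : nu set0 = 0%E.
Proof. by rewrite /nu /pushforward preimage_set0 measure0. Qed.

Let nu_ge0 A : (0 <= nu A)%E.
Proof. by rewrite /nu /pushforward; exact: measure_ge0. Qed.

Let nu_sigma_additive : semi_sigma_additive nu.
Proof.
move=> F mF tF mUF; rewrite /nu /pushforward preimage_bigcup.
apply: measure_semi_sigma_additive.
- by move=> k; exact: mcons.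
- apply/trivIsetP => /= i j _ _ ij; rewrite -preimage_setI.
  by move/trivIsetP : tF => /(_ _ _ _ _ ij) ->//; rewrite preimage_set0.
- by rewrite -preimage_bigcup; exact: mcons.
Qed.

HB.instance Definition _ := isMeasure.Build _ _ _ nu
  nu0 nu_ge0 nu_sigma_additive.

Let sigma_finite_nu : sigma_finite setT nu.
Proof.
have /sigma_finiteP[F [TF ndF Foo]] := sigma_finiteT (@lebesgue_measure R).
have /sigma_finiteP[G [TG ndG Goo]] := sigma_finiteT mu.
pose uncons (t : n.+1.-tuple R) : measurableTypeR R * n.-tuple R :=
  (thead t, [tuple of behead t]).
have consK : cancel (@cons_pair R n) uncons.
  move=> [x t]; rewrite /uncons /cons_pair/= theadE.
  by congr pair; apply/val_inj.
have munc : measurable_fun setT uncons.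
  apply/measurable_fun_pairP; split; last exact: measurable_behead.
  exact: measurable_tnth.
exists (fun k => uncons @^-1` (F k `*` G k)).
  apply/esym/seteqP; split=> // t _.
  have [k _ Fk] : (\bigcup_k F k) (uncons t).1 by rewrite -TF.
  have [l _ Gl] : (\bigcup_k G k) (uncons t).2 by rewrite -TG.
  exists (maxn k l) => //; split.
  - by move: Fk; exact/subsetPset/ndF/leq_maxl.
  - by move: Gl; exact/subsetPset/ndG/leq_maxr.
move=> k; have [mF Fk] := Foo k; have [mG Gk] := Goo k.
split.
  by rewrite -[X in measurable X]setTI; apply: munc => //; exact: measurableX.
rewrite /nu /pushforward -comp_preimage.
rewrite (_ : uncons \o _ = id) ?preimage_id; last exact/funext.
by rewrite product_measure1E// lte_mul_pinfty// ge0_fin_numE.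
Qed.

HB.instance Definition _ := Measure_isSigmaFinite.Build _ _ _ nu
  sigma_finite_nu.

Definition lebesgue_tuple_step :
  {sigma_finite_measure set (n.+1.-tuple R) -> \bar R} := nu.

End lebesgue_tuple_step.

Section lebesgue_tuple_measure.
Context (R : realType) (n : nat).

Let lebesgue_tupleP :
  exists mu : {sigma_finite_measure set (n.-tuple R) -> \bar R},
  mu = @lebesgue_tuple R n :> (set _ -> _).
Proof.
elim: n => [|k [mu muE]]; first by exists \d_([tuple] : 0.-tuple R).
by exists (lebesgue_tuple_step mu); rewrite /= -muE.
Qed.

Let mu0 : @lebesgue_tuple R n set0 = 0%E.
Proof. by have [mu <-] := lebesgue_tupleP; exact: measure0. Qed.

Let mu_ge0 A : (0 <= @lebesgue_tuple R n A)%E.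
Proof. by have [mu <-] := lebesgue_tupleP; exact: measure_ge0. Qed.

Let mu_sigma_additive : semi_sigma_additive (@lebesgue_tuple R n).
Proof.
by have [mu <-] := lebesgue_tupleP; exact: measure_semi_sigma_additive.
Qed.

HB.instance Definition _ := isMeasure.Build _ _ _ (@lebesgue_tuple R n)
  mu0 mu_ge0 mu_sigma_additive.

Let mu_sigma_finite : sigma_finite setT (@lebesgue_tuple R n).
Proof. by have [mu <-] := lebesgue_tupleP; exact: sigma_finiteT. Qed.

HB.instance Definition _ := Measure_isSigmaFinite.Build _ _ _
  (@lebesgue_tuple R n) mu_sigma_finite.

End lebesgue_tuple_measure.

Lemma lebesgue_tuple_box (R : realType) n (A : 'I_n -> set R) :
  (forall i, measurable (A i)) ->
  lebesgue_tuple [set x : n.-tuple R | forall i, A i (tnth x i)] =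
  (\prod_(i < n) lebesgue_measure (A i))%E.
Proof.
elim: n A => [|n IH] A mA.
  by rewrite big_ord0 /= diracE mem_set// => -[].
rewrite big_ord_recl -IH//= -product_measure1E//.
  rewrite /pushforward; congr (_ _); apply/seteqP; split=> -[x t] /=.
    by move=> h; split=> [|i];
      [exact: (h ord0)|have := h (lift ord0 i); rewrite tnthS].
  move=> [Ax At] i; case: (unliftP ord0 i) => [j ->|->//].
  by rewrite tnthS.
  exact: mA.
rewrite (_ : [set x : n.-tuple R | _] =
  \bigcap_(i in [set: 'I_n]) ((@tnth _ _ ^~ i) @^-1` A (lift ord0 i))); last first.
  by apply/seteqP; split=> x /= h i; [move=> _|]; exact: h.
apply: fin_bigcap_measurable => // i _.
by rewrite -[X in measurable X]setTI; exact: measurable_tnth.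
Qed.

(* Y_{i,j} in the row-major enumeration of the array, with the 1-based indices
   1 <= i <= m and 1 <= j <= n; other indices are not meaningful. *)
Definition array_entry (R : realType) (m n : nat) (y : (m * n).-tuple R) (i j : nat)
  : R := y`_(i.-1 * n + j.-1).

Definition increasing_arrays (R : realType) (m n : nat) : set ((m * n).-tuple R) :=
  [set y | forall i j, (1 <= i <= m)%N -> (1 <= j <= n)%N ->
    [/\ 0 <= array_entry y i j <= 1,
        ((j < n)%N -> array_entry y i j < array_entry y i j.+1) &
        ((i < m)%N -> array_entry y i j < array_entry y i.+1 j)]].

(* The l-tuple (Y_{1,c+1}, Y_{2,c+2}, ..., Y_{l,c+l}). *)
Definition diagonal_tuple (R : realType) (m n l c : nat) (y : (m * n).-tuple R)
  : l.-tuple R := [tuple array_entry y i.+1 (c + i.+1) | i < l].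

Lemma measurable_array_entry (R : realType) m n i j :
  measurable_fun setT (fun y : (m * n).-tuple R => array_entry y i j).
Proof.
rewrite /array_entry; have [lt_k|ge_k] := ltnP (i.-1 * n + j.-1) (m * n); last first.
  under eq_fun do rewrite nth_default ?size_tuple//.
  exact: measurable_cst.
under eq_fun do rewrite -[(_ + _)%N]/(nat_of_ord (Ordinal lt_k)) -tnth_nth.
exact: measurable_tnth.
Qed.

Lemma measurable_diagonal_tuple (R : realType) m n l c :
  measurable_fun setT (@diagonal_tuple R m n l c).
Proof.
apply/measurable_fun_tnthP => i.
rewrite (_ : _ \o _ = fun y => array_entry y i.+1 (c + i.+1)).
  exact: measurable_array_entry.
by apply/funext => y /=; rewrite tnth_mktuple.
Qed.

HB.instance Definition _ (R : realType) m n l c :=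
  isMeasurableFun.Build _ _ _ _ (@diagonal_tuple R m n l c)
    (@measurable_diagonal_tuple R m n l c).

Definition uniform_on (d : measure_display) (T : measurableType d)
    (R : realType) (P : probability T R) (N : nat) (X : {RV P >-> N.-tuple R})
    (D : set (N.-tuple R)) : Prop :=
  forall A : set (N.-tuple R), measurable A ->
    distribution P X A = (lebesgue_tuple (A `&` D) / lebesgue_tuple D)%E.

Definition has_density_on (d : measure_display) (T : measurableType d)
    (R : realType) (P : probability T R) (k : nat) (X : {RV P >-> k.-tuple R})
    (D : set (k.-tuple R)) (f : k.-tuple R -> R) : Prop :=
  [/\ measurable_fun D f, (forall x, D x -> 0 <= f x) &
    forall A : set (k.-tuple R), measurable A ->
      distribution P X A =
      (\int[@lebesgue_tuple R k]_(x in A `&` D) (f x)%:E)%E].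

Definition has_density_propto_on (d : measure_display) (T : measurableType d)
    (R : realType) (P : probability T R) (k : nat) (X : {RV P >-> k.-tuple R})
    (D : set (k.-tuple R)) (g : k.-tuple R -> R) : Prop :=
  exists2 c : R, 0 < c & has_density_on X D (fun x => c * g x).

Definition unit_cube (R : realType) (k : nat) : set (k.-tuple R) :=
  [set x | forall i, 0 <= tnth x i <= 1].

Definition vandermonde (R : realType) (k : nat) (x : k.-tuple R) : R :=
  \prod_(i < k) \prod_(j < k | (i < j)%N) (tnth x i - tnth x j).

(* The weight 1_{x_1 <= ... <= x_k} Delta(x)^2 prod_i x_i^a (1 - x_i)^b. *)
Definition jacobi_weight (R : realType) (k a b : nat) (x : k.-tuple R) : R :=
  (sorted <=%R x)%:R * vandermonde x ^+ 2 *
  \prod_(i < k) (tnth x i ^+ a * (1 - tnth x i) ^+ b).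

(* Main.v *)
(** Cut the rectangle into its diagonals j - i = const and integrate them out one
    at a time, starting from the corner (m, 1) and from the corner (1, n), towards
    the diagonal of interest. Given the next diagonal x, the entries of the current
    one range independently over the intervals of a subdivision whose endpoints are
    the entries of x, together with 0 and/or 1 at the ends of the diagonal lying on
    the boundary of the rectangle. A weight Delta(y) prod y^a (1-y)^b is a
    determinant with one variable per column, so its integral over such a box is
    computed column by column; with well-chosen antiderivatives the result is a
    constant times Delta(x) prod x^a' (1-x)^b', where a' = a + 1 if the endpoint 0
    occurs (and a' = a otherwise), and likewise for b' and the endpoint 1 (special
    cases of the Dixon-Anderson integral). The two sides of the diagonal
    contribute one factor Delta each. The constants, including their signs, are never
    computed: the total volume being positive settles the sign of their product. *)

Require Import Defs.
From mathcomp Require Import all_boot all_order all_algebra.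
From mathcomp Require Import all_classical all_reals all_analysis.
From mathcomp Require Import measurable_realfun.
From mathcomp Require Import zify ring.

Set Implicit Arguments.
Unset Strict Implicit.
Unset Printing Implicit Defensive.

Import Order.TTheory GRing.Theory Num.Theory.
Import numFieldNormedType.Exports.

Local Open Scope classical_set_scope.
Local Open Scope ring_scope.

(** * Iterated integrals over coordinates of R^N *)

Section iterated_integral.
Context (R : realType) (N : nat).
Implicit Types (y z : N.-tuple R) (f : N.-tuple R -> \bar R) (s : seq nat).

(** Tuples keep their length [N] during integration: coordinates are named by their index, and an
    order of integration is a list of indices. An index [k >= N] leaves [y] unchanged. *)
Definition upd y (k : nat) (x : R) : N.-tuple R :=
  [tuple if val i == k then x else tnth y i | i < N].

Lemma nth_upd y k x l :
  (upd y k x)`_l = if (l == k) && (k < N)%N then x else y`_l.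
Proof.
have [lN|lN] := ltnP l N.
  rewrite -(tnth_nth 0 _ (Ordinal lN)) tnth_mktuple /= (tnth_nth 0).
  by case: eqP => //= <-; rewrite lN.
rewrite !nth_default ?size_tuple//; case: eqP => //= <-.
by rewrite ltnNge lN.
Qed.

Lemma nth_upd_eq y k x : (k < N)%N -> (upd y k x)`_k = x.
Proof. by move=> kN; rewrite nth_upd eqxx kN. Qed.

Lemma nth_upd_neq y k x l : l != k -> (upd y k x)`_l = y`_l.
Proof. by move=> /negPf lk; rewrite nth_upd lk. Qed.

Lemma eq_nth_tuple y z : (forall l, (l < N)%N -> y`_l = z`_l) -> y = z.
Proof. by move=> h; apply: eq_from_tnth => i; rewrite !(tnth_nth 0) h. Qed.

Lemma updC y k l x x' : k != l -> upd (upd y k x) l x' = upd (upd y l x') k x.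
Proof.
move=> kl; apply: eq_nth_tuple => i iN; rewrite !nth_upd.
by case: (eqVneq i l) => [->|//]; rewrite eq_sym (negPf kl); case: ifP.
Qed.

Lemma measurable_upd k :
  measurable_fun setT (fun p : N.-tuple R * measurableTypeR R => upd p.1 k p.2).
Proof.
apply/measurable_fun_tnthP => i.
rewrite (_ : _ \o _ = fun p : N.-tuple R * measurableTypeR R =>
  if val i == k then p.2 else tnth p.1 i); last first.
  by apply/funext => p /=; rewrite tnth_mktuple.
case: (val i == k); first exact: measurable_snd.
exact: measurableT_comp (measurable_tnth i) measurable_fst.
Qed.

Lemma measurable_upd2 y k l :
  measurable_fun setT (fun p : measurableTypeR R * measurableTypeR R =>
    upd (upd y k p.1) l p.2).
Proof.
apply/measurable_fun_tnthP => i.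
rewrite (_ : _ \o _ = fun p : measurableTypeR R * measurableTypeR R =>
  if val i == l then p.2 else if val i == k then p.1 else tnth y i); last first.
  by apply/funext => p /=; rewrite !tnth_mktuple.
case: (val i == l); first exact: measurable_snd.
by case: (val i == k); first exact: measurable_fst.
Qed.

(* The coordinates of y listed in s are dummies: they are integrated out. *)
Fixpoint iint s f y : \bar R :=
  if s is k :: s' then
    (\int[@lebesgue_measure R]_(x in setT) iint s' f (upd y k x))%E
  else f y.

Lemma iint_cat s t f y : iint (s ++ t) f y = iint s (iint t f) y.
Proof.
elim: s y => //= k s IH y; apply: eq_integral => x _; exact: IH.
Qed.

Lemma eq_iint s f g y :
  (forall z, (forall l, l \notin s -> z`_l = y`_l) -> f z = g z) ->
  iint s f y = iint s g y.
Proof.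
elim: s y => /= [|k s IH] y fg; first exact: fg.
apply: eq_integral => x _; apply: IH => z zE; apply: fg => l.
rewrite inE negb_or => /andP[lk ls]; rewrite zE//.
by rewrite nth_upd_neq.
Qed.

Lemma iint_ge0 s f y : (forall z, (0 <= f z)%E) -> (0 <= iint s f y)%E.
Proof.
move=> f0; elim: s y => //= k s IH y.
by apply: integral_ge0.
Qed.

Lemma measurable_iint s f : measurable_fun [set: N.-tuple R] f ->
  (forall z, (0 <= f z)%E) -> measurable_fun [set: N.-tuple R] (iint s f).
Proof.
move=> mf f0; elim: s => //= k s IH.
have := @measurable_fun_fubini_tonelli_F _ _ (N.-tuple R) (measurableTypeR R) R
  lebesgue_measure (fun p => iint s f (upd p.1 k p.2)).
apply; first exact: measurableT_comp (measurable_upd k).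
by move=> p; exact: iint_ge0.
Qed.

Lemma iint_swap k l s f y : measurable_fun [set: N.-tuple R] f -> (forall z, (0 <= f z)%E) ->
  iint (k :: l :: s) f y = iint (l :: k :: s) f y.
Proof.
move=> mf f0 /=; have [->//|kl] := eqVneq k l.
pose F (p : measurableTypeR R * measurableTypeR R) :=
  iint s f (upd (upd y k p.1) l p.2).
have mF : measurable_fun setT F.
  apply: measurableT_comp; first exact: measurable_iint.
  exact: measurable_upd2.
have F0 p : (0 <= F p)%E by exact: iint_ge0.
rewrite -[LHS]/(\int[lebesgue_measure]_x \int[lebesgue_measure]_x' F (x, x'))%E.
rewrite (@fubini_tonelli _ _ _ _ R lebesgue_measure lebesgue_measure F mF F0).
apply: eq_integral => x _; apply: eq_integral => x' _.
by rewrite /F updC.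
Qed.

Lemma perm_iint s t f y : measurable_fun [set: N.-tuple R] f -> (forall z, (0 <= f z)%E) ->
  perm_eq s t -> iint s f y = iint t f y.
Proof.
move=> mf f0.
(* Adjacent swaps, each an instance of Tonelli's theorem, bring any listed coordinate to the
   front. *)
have move_front k u v w : iint (u ++ k :: v) f w = iint (k :: u ++ v) f w.
  elim: u w => //= l u IH w.
  transitivity (iint [:: l, k & u ++ v] f w); last exact: iint_swap.
  by apply: eq_integral => x _; rewrite IH.
elim: s t y => [|k s IH] t y st.
  by move: st; rewrite perm_sym => /perm_nilP ->.
have kt : k \in t by rewrite -(perm_mem st) mem_head.
case/splitPr: kt st => u v st.
rewrite move_front /=; apply: eq_integral => x _; apply: IH.
by rewrite -(perm_cons k) (perm_trans st)// -cat1s perm_catCA.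
Qed.

(** Lebesgue measure on tuples is built by adding one coordinate in front, so Tonelli's theorem
    peels off the coordinates in [D] one by one. This later turns an iterated integral over the
    cells of a diagonal into an integral over R^k. *)
Lemma iint_lebesgue_tuple (k : nat) (D : seq nat) (g : k.-tuple R -> \bar R) y :
  size D = k -> uniq D -> all (fun l => l < N)%N D ->
  measurable_fun [set: k.-tuple R] g -> (forall x, (0 <= g x)%E) ->
  iint D (fun z => g [tuple z`_(nth 0%N D i) | i < k]) y =
  (\int[@lebesgue_tuple R k]_x g x)%E.
Proof.
elim: k D g y => [|k IH] [|d D]//= g y.
  move=> _ _ _ mg g0; rewrite integral_dirac//= diracT mul1e.
  by rewrite [X in g X]tuple0.
move=> [sD] /andP[dD uD] /andP[dN aD] mg g0.
have mcx x : measurable_fun setT (fun t : k.-tuple R => cons_pair (x, t)).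
  exact: (@measurable_cons _ _ _ _ (fun=> x) k id).
transitivity (\int[@lebesgue_measure R]_x \int[@lebesgue_tuple R k]_t g (cons_pair (x, t)))%E.
  apply: eq_integral => x _.
  rewrite -(IH D (fun t => g (cons_pair (x, t))) (upd y d x))//; last first.
    exact: (measurableT_comp mg (mcx x)).
  apply: eq_iint => z zE; congr g; apply: eq_from_tnth => i.
  rewrite tnth_mktuple; case: (unliftP ord0 i) => [j|] ->.
    by rewrite /cons_pair /= tnthS tnth_mktuple.
  by rewrite /cons_pair /= zE// nth_upd_eq.
have mc := @measurable_cons_pair R k.
rewrite ge0_integral_pushforward//.
rewrite preimage_setT fubini_tonelli1//; last by move=> z; exact: g0.
exact: (measurableT_comp mg mc).
Qed.

Lemma lebesgue_tuple_iint (A : set (N.-tuple R)) y0 : measurable A ->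
  lebesgue_tuple A = iint (iota 0 N) (fun z => (\1_A z)%:E) y0.
Proof.
move=> mA.
transitivity (\int[@lebesgue_tuple R N]_x (\1_A x)%:E)%E.
  by rewrite integral_indic// setIT.
rewrite -(@iint_lebesgue_tuple N (iota 0 N) _ y0) ?size_iota ?iota_uniq//.
- congr iint; apply/funext => z; congr (\1_A _)%:E; apply: eq_from_tnth => i.
  by rewrite tnth_mktuple nth_iota// (tnth_nth 0).
- by apply/allP => l; rewrite mem_iota.
- by apply/measurable_EFinP; exact: measurable_indic.
Qed.

End iterated_integral.

(** * Interlacing integrals of determinants *)

Section box_integral.
Context (R : realType).

(** The fundamental theorem of calculus, with an indicator in place of the domain so that it fits
    [iint]. Endpoints are null sets, hence the arbitrary [b0] and [b1]. *)
Lemma integral_deriv_horner (F : {poly R}) (l u : R) (b0 b1 : bool) : l <= u ->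
  (\int[@lebesgue_measure R]_(x in setT)
     ((x \in Interval (BSide b0 l) (BSide b1 u))%:R * F^`().[x])%:E =
   (F.[u] - F.[l])%:E)%E.
Proof.
move=> lu; set I := Interval _ _.
transitivity (\int[@lebesgue_measure R]_(x in [set` I]) (F^`().[x])%:E)%E.
  rewrite [RHS]integral_mkcond; apply: eq_integral => x _.
  rewrite patchE mem_setE; case: (x \in I); first by rewrite mul1r.
  by rewrite mul0r.
have mF (A : set R) : measurable_fun A (EFin \o horner F^`()).
  apply/measurable_EFinP/measurable_funTS; apply: continuous_measurable_fun.
  exact/continuous_horner.
rewrite integral_itv_bndoo; last exact: mF.
move: lu; rewrite le_eqVlt => /orP[/eqP->|lu].
  by rewrite set_itvoo0 integral_set0 subrr.
(* [true false] encodes the closed interval, the shape required by [continuous_FTC2]. *)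
rewrite -(@integral_itv_bndoo _ _ _ _ true false); last exact: mF.
rewrite (@continuous_FTC2 _ _ (horner F)) ?EFinB//.
- by apply: continuous_subspaceT; exact: continuous_horner.
- split.
  + by move=> x _; exact: derivable_horner.
  + by apply: cvg_at_right_filter; exact: continuous_horner.
  + by apply: cvg_at_left_filter; exact: continuous_horner.
- by move=> x _; rewrite derivE.
Qed.

Variable N : nat.
Implicit Types (y w : N.-tuple R).

(** A determinant is linear in each column and each variable occurs in one column only, so
    integrating a variable turns the derivatives in its column into increments. *)
Lemma iint_box_det (l : nat) (c : nat -> nat) (z : nat -> R) (bl br : nat -> bool)
    (F : nat -> {poly R}) (K : R) (f : N.-tuple R -> \bar R) y :
  (forall j, (j < l)%N -> z j <= z j.+1) ->
  {in gtn l &, injective c} -> (forall j, (j < l)%N -> (c j < N)%N) ->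
  (forall w, (forall k, k \notin mkseq c l -> w`_k = y`_k) ->
    f w = (K * (\prod_(j < l) (w`_(c j) \in
        Interval (BSide (bl j) (z j)) (BSide (br j) (z j.+1)))%:R) *
      \det (\matrix_(i < l, j < l) (F i)^`().[w`_(c j)]))%:E) ->
  iint (mkseq c l) f y =
    (K * \det (\matrix_(i < l, j < l) ((F i).[z j.+1] - (F i).[z j])))%:E.
Proof.
move=> zle c_inj cN fE.
pose I j := Interval (BSide (bl j) (z j)) (BSide (br j) (z j.+1)).
(* Intermediate stage: columns [j < k] still carry their variable, the others are already
   integrated. The last listed variable is the innermost one. *)
pose M k w := \matrix_(i < l, j < l) (if (j < k)%N then (F i)^`().[w`_(c j)]
  else (F i).[z j.+1] - (F i).[z j]).
pose H k w := K * (\prod_(j < l | (j < k)%N) (w`_(c j) \in I j)%:R) * \det (M k w).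
suff Hint k w : (k <= l)%N ->
    iint (mkseq c k) (fun w => (H k w)%:E) w = (H 0 w)%:E.
  transitivity (iint (mkseq c l) (fun w => (H l w)%:E) y).
    apply: eq_iint => w wy; rewrite fE// /H /M; congr (_ * _ * _)%:E.
      by apply: eq_bigl => j; rewrite ltn_ord.
    by congr (\det _); apply/matrixP => i j; rewrite !mxE ltn_ord.
  rewrite Hint// /H big_pred0// mulr1; congr (_ * \det _)%:E.
elim: k w => [//|k IH] w kl; rewrite mkseqS -cats1 iint_cat -IH ?(ltnW kl)//.
congr (iint _ _ _); apply/funext => {}w /=.
pose k' := Ordinal kl.
pose P := K * \prod_(j < l | (j < k)%N) (w`_(c j) \in I j)%:R.
(* The cofactors along column [k] do not contain the variable [c k], so the integrand is the
   derivative of this single polynomial on the interval. *)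
pose Q := \sum_(i < l) (P * cofactor (M k w) i k') *: F i.
have cc (j : 'I_l) : (j != k')%N -> c j != c k.
  by apply: contra => /eqP/c_inj cjk; apply/eqP/val_inj/cjk; rewrite inE.
transitivity (\int[@lebesgue_measure R]_(x in setT) ((x \in I k)%:R * Q^`().[x])%:E)%E.
  apply: eq_integral => x _; congr EFin.
  rewrite /H (bigD1 k')//= nth_upd_eq ?cN//.
  rewrite (eq_big (fun j : 'I_l => (j < k)%N) (fun j : 'I_l => (w`_(c j) \in I j)%:R)); last 2 first.
  - move=> j; rewrite ltnS ltn_neqAle andbC; congr (_ && _).
  - by move=> j /andP[_ jk]; rewrite nth_upd_neq ?cc.
  rewrite mulrCA -mulrA; congr (_ * _); rewrite -/P (expand_det_col _ k').
  rewrite /Q raddf_sum horner_sum mulr_sumr; apply: eq_bigr => i _.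
  rewrite /= derivZ hornerZ !mxE /= ltnSn nth_upd_eq ?cN//.
  rewrite -[RHS]mulrA [in RHS](mulrC (cofactor _ _ _)); congr (_ * (_ * _)); rewrite /cofactor; congr (_ * \det _).
  apply/matrixP => i' j'; rewrite !mxE.
  have jk : lift k' j' != k' by rewrite eq_sym neq_lift.
  rewrite nth_upd_neq ?cc// ltnS leq_eqVlt.
  by rewrite -[(lift k' j' == k :> nat)]/(lift k' j' == k') (negPf jk).
rewrite integral_deriv_horner ?zle//; congr EFin.
rewrite /H -/P (expand_det_col _ k') /Q !horner_sum -sumrB mulr_sumr.
apply: eq_bigr => i _; rewrite !hornerZ -mulrBr !mxE /= ltnn.
by rewrite -mulrA (mulrC (cofactor _ _ _)).
Qed.

End box_integral.

(** * Determinant identities: graded rows, bordered matrices, column differences *)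

Section determinants.
Context (R : realType).
Implicit Types (v : nat -> nat -> R) (x z : nat -> R).

Lemma det_scale_cols l v (w : nat -> R) :
  \det (\matrix_(i < l, j < l) (v i j * w j)) =
  \det (\matrix_(i < l, j < l) v i j) * \prod_(j < l) w j.
Proof.
have -> : \matrix_(i < l, j < l) (v i j * w j) =
    \matrix_(i < l, j < l) v i j *m diag_mx (\row_(j < l) w j).
  by apply/matrixP => i j; rewrite mul_mx_diag !mxE.
by rewrite det_mulmx det_diag; congr (_ * _); apply: eq_bigr => j _; rewrite mxE.
Qed.

(** The matrix is a lower triangular matrix of coefficients times a Vandermonde matrix. *)
Lemma det_horner_graded l (q : nat -> {poly R}) x :
  (forall i, (size (q i) <= i.+1)%N) ->
  \det (\matrix_(i < l, j < l) (q i).[x j]) =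
  (\prod_(i < l) (q i)`_i) * \det (\matrix_(i < l, j < l) x j ^+ i).
Proof.
move=> sq.
have -> : \matrix_(i < l, j < l) (q i).[x j] =
    (\matrix_(i < l, k < l) (q i)`_k) *m (\matrix_(i < l, j < l) x j ^+ i).
  apply/matrixP => i j; rewrite !mxE (@horner_coef_wide _ l).
    by apply: eq_bigr => k _; rewrite !mxE.
  exact: leq_trans (sq i) _.
rewrite det_mulmx det_trig; last first.
  apply/is_trig_mxP => i j ij; rewrite mxE nth_default//.
  exact: leq_trans (sq i) _.
by congr (_ * _); apply: eq_bigr => i _; rewrite mxE.
Qed.

Lemma det_border_first_col l v : (forall i, v i 0%N = (i == 0%N)%:R) ->
  \det (\matrix_(i < l.+1, j < l.+1) v i j) =
  \det (\matrix_(i < l, j < l) v i.+1 j.+1).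
Proof.
move=> v0; rewrite (expand_det_col _ ord0) big_ord_recl big1 ?addr0.
  rewrite mxE v0 mul1r /cofactor expr0 mul1r; congr (\det _).
  by apply/matrixP => i j; rewrite !mxE.
by move=> i _; rewrite mxE v0 mul0r.
Qed.

Lemma det_border_last_col l v (e : R) : (forall i, v i l = (i == 0%N)%:R * e) ->
  \det (\matrix_(i < l.+1, j < l.+1) v i j) =
  (-1) ^+ l * e * \det (\matrix_(i < l, j < l) v i.+1 j).
Proof.
move=> vl; rewrite (expand_det_col _ ord_max) big_ord_recl big1 ?addr0.
  rewrite mxE vl mul1r /cofactor /= add0n mulrCA mulrA; congr (_ * \det _).
  by apply/matrixP => i j; rewrite !mxE lift_max.
by move=> i _; rewrite mxE vl mul0r mul0r.
Qed.

(* Subtracting each column from the next one turns the first row [1, ..., 1]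
   into [1, 0, ..., 0]. *)
Lemma det_differences l v : (forall j, v 0%N j = 1) ->
  \det (\matrix_(i < l, j < l) (v i.+1 j.+1 - v i.+1 j)) =
  \det (\matrix_(i < l.+1, j < l.+1) v i j).
Proof.
move=> v0.
(* Right multiplication by this unipotent bidiagonal matrix performs the column operations. *)
pose D := \matrix_(i < l.+1, j < l.+1)
  ((i == j)%:R - (i.+1 == j :> nat)%:R : R).
have detD : \det D = 1.
  rewrite -det_tr det_trig; last first.
    apply/is_trig_mxP => i j ij; rewrite !mxE -val_eqE /=.
    by rewrite !gtn_eqF ?subrr// ltnS ltnW.
  by rewrite big1// => i _; rewrite !mxE eqxx gtn_eqF ?subr0.
rewrite -[RHS]mulr1 -detD -det_mulmx.
have -> : \matrix_(i < l.+1, j < l.+1) v i j *m D =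
    \matrix_(i < l.+1, j < l.+1) (v i j - (if val j is j'.+1 then v i j' else 0)).
  apply/matrixP => i j; rewrite [LHS]mxE [RHS]mxE; under eq_bigr do rewrite !mxE mulrBr.
  rewrite sumrB; congr (_ - _).
    rewrite (bigD1 j)//= eqxx mulr1 big1 ?addr0// => k /negPf kj.
    by rewrite kj mulr0.
  case: j => -[|j] jl /=; first by rewrite big1// => k _; rewrite mulr0.
  rewrite (bigD1 (Ordinal (ltnW jl)))//= eqxx mulr1 big1 ?addr0// => k.
  by rewrite -val_eqE eqSS /= => /negPf ->; rewrite mulr0.
rewrite (expand_det_row _ ord0) big_ord_recl big1 ?addr0.
  rewrite mxE /= v0 subr0 mul1r /cofactor expr0 mul1r; congr (\det _).
  by apply/matrixP => i j; rewrite !mxE.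
by move=> j _; rewrite mxE /= !v0 subrr mul0r.
Qed.

(** Unlike [jacobi_weight], it contains the Vandermonde factor to the first power and no ordering
    indicator: it is what one side of a diagonal contributes. *)
Definition jacobi_det l a b x : R :=
  \det (\matrix_(i < l, j < l) x j ^+ i) *
  \prod_(j < l) (x j ^+ a * (1 - x j) ^+ b).

Lemma jacobi_detE l a b x : jacobi_det l a b x =
  \det (\matrix_(i < l, j < l) (x j ^+ i * (x j ^+ a * (1 - x j) ^+ b))).
Proof.
by rewrite (det_scale_cols l (fun i j => x j ^+ i) (fun j => x j ^+ a * (1 - x j) ^+ b)).
Qed.

(** Row [i] may be any polynomial of exact degree [i] times the common weight, at the price of a
    nonzero constant. This freedom is used to choose rows with convenient antiderivatives. *)
Lemma jacobi_det_graded l a b (p q : nat -> {poly R}) x :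
  (forall i, p i = q i * ('X ^+ a * (1 - 'X) ^+ b)) ->
  (forall i, (size (q i) <= i.+1)%N) -> (forall i, (q i)`_i != 0) ->
  jacobi_det l a b x =
  (\prod_(i < l) (q i)`_i)^-1 * \det (\matrix_(i < l, j < l) (p i).[x j]).
Proof.
move=> pE sq q0.
have -> : \matrix_(i < l, j < l) (p i).[x j] =
    \matrix_(i < l, j < l) ((q i).[x j] * (x j ^+ a * (1 - x j) ^+ b)).
  by apply/matrixP => i j; rewrite !mxE pE !hornerE.
rewrite (det_scale_cols _ (fun i j => (q i).[x j]) (fun j => x j ^+ a * (1 - x j) ^+ b)).
rewrite det_horner_graded// -mulrA mulKf//.
by apply/prodf_neq0 => i _.
Qed.

Lemma antiderivative_poly (p : {poly R}) :
  exists2 P : {poly R}, P^`() = p & P.[0] = 0.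
Proof.
exists (\poly_(i < (size p).+1) (p`_i.-1 / i%:R)).
  apply/polyP => i; rewrite coef_deriv coef_poly ltnS.
  case: ltnP => [_|/(nth_default 0) ->]; last by rewrite mul0rn.
  by rewrite -[LHS]mulr_natr divfK// pnatr_eq0.
by rewrite horner_coef0 coef_poly /= invr0 mulr0.
Qed.

End determinants.

(** * Integration of one diagonal, for each choice of boundary endpoints *)

Section interlacing_steps.
Context (R : realType).
Implicit Types (x y z : nat -> R).

(* The weight jacobi_det l a b integrates, over the box of the y j in
   [z j, z j.+1], to a constant times t z, for every z satisfying P. The F i are
   antiderivatives of the rows of a determinant proportional to the weight. *)
Definition interlacing_step l a b (P : (nat -> R) -> Prop) (t : (nat -> R) -> R) :=
  exists (F : nat -> {poly R}) (C1 C2 : R),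
    (forall y, jacobi_det l a b y =
      C1 * \det (\matrix_(i < l, j < l) (F i)^`().[y j])) /\
    (forall z, P z -> \det (\matrix_(i < l, j < l) ((F i).[z j.+1] - (F i).[z j])) =
      C2 * t z).

Lemma size_two_terms (d : R) i :
  (size ('X^(i.-1) *+ i - d *: 'X^i : {poly R})%R <= i.+1)%N.
Proof.
apply/leq_sizeP => j ij; rewrite coefB coefMn !coefZ !coefXn.
by rewrite !gtn_eqF ?mulr0 ?mul0rn ?subr0//; case: i ij => //= i /ltnW.
Qed.

(** The increments of the powers ['X^(i.+1)] are column differences of a Vandermonde matrix of size
    [l.+1] without its row of ones; [det_differences] restores that row. *)
Lemma interlacing_step_grow l :
  interlacing_step l 0 0 (fun=> True) (jacobi_det l.+1 0 0).
Proof.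
pose q i : {poly R} := i.+1%:R *: 'X^i.
pose F i : {poly R} := 'X^(i.+1).
exists F, (\prod_(i < l) (q i)`_i)^-1, 1; split=> [y|z _].
  apply: (@jacobi_det_graded _ _ _ _ (fun i => (F i)^`()) q) => i.
  - by rewrite !expr0 !mulr1 derivXn -scaler_nat.
  - by rewrite (leq_trans (size_scale_leq _ _)) ?size_polyXn.
  - by rewrite coefZ coefXn eqxx mulr1 pnatr_eq0.
pose v i j := z j ^+ i.
transitivity (\det (\matrix_(i < l, j < l) (v i.+1 j.+1 - v i.+1 j))).
  by congr (\det _); apply/matrixP => i j; rewrite !mxE !hornerXn.
rewrite det_differences// mul1r /jacobi_det [X in _ * X]big1 ?mulr1// => i _.
by rewrite !expr0 mulr1.
Qed.

(** Every [F i] vanishes at [z 0 = 0], so once the row of ones is restored the first column is a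
    unit vector and the point [z 0] drops out. *)
Lemma interlacing_step_zero l a :
  interlacing_step l a 0 (fun z => z 0%N = 0)
    (fun z => jacobi_det l a.+1 0 (fun j => z j.+1)).
Proof.
pose q i : {poly R} := (a.+1 + i)%:R *: 'X^i.
pose F i : {poly R} := 'X^(a.+1 + i).
exists F, (\prod_(i < l) (q i)`_i)^-1, 1; split=> [y|z z0].
  apply: (@jacobi_det_graded _ _ _ _ (fun i => (F i)^`()) q) => i.
  - rewrite expr0 mulr1 derivXn -scaler_nat addSn /= /q -scalerAl -exprD.
    by rewrite addSn addnC.
  - by rewrite (leq_trans (size_scale_leq _ _)) ?size_polyXn.
  - by rewrite coefZ coefXn eqxx mulr1 pnatr_eq0.
pose v i j := if i is i'.+1 then z j ^+ (a.+1 + i') else 1.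
transitivity (\det (\matrix_(i < l, j < l) (v i.+1 j.+1 - v i.+1 j))).
  by congr (\det _); apply/matrixP => i j; rewrite !mxE !hornerXn.
rewrite det_differences// det_border_first_col; last first.
  by case=> //= i; rewrite z0 addSn expr0n.
rewrite mul1r jacobi_detE; congr (\det _).
by apply/matrixP => i j; rewrite !mxE /= expr0 mulr1 exprD mulrC.
Qed.

(** Every [F i] vanishes at [z l = 1], so the last column drops out; its cofactor sign is the
    constant. *)
Lemma interlacing_step_one l b :
  interlacing_step l 0 b (fun z => z l = 1) (jacobi_det l 0 b.+1).
Proof.
(* The quotient of the derivative of [F i] by [(1 - 'X) ^+ b]; its leading coefficient is
   nonzero. *)
pose q i : {poly R} := 'X^(i.-1) *+ i - (i + b.+1)%:R *: 'X^i.
pose F i : {poly R} := 'X^i * (1 - 'X) ^+ b.+1.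
exists F, (\prod_(i < l) (q i)`_i)^-1, ((-1) ^+ l); split=> [y|z zl].
  apply: (@jacobi_det_graded _ _ _ _ (fun i => (F i)^`()) q) => i.
  - rewrite expr0 mul1r derivM derivXn deriv_exp derivB derivX derivC sub0r /q.
    rewrite exprS -mul_polyC polyC_natr.
    by case: i => [|i]; rewrite /= ?exprS; ring.
  - exact: size_two_terms.
  - rewrite coefB coefMn !coefZ !coefXn eqxx mulr1.
    case: i => [|i] /=; first by rewrite mulr0n sub0r oppr_eq0 pnatr_eq0.
    by rewrite gtn_eqF// mul0rn sub0r oppr_eq0 pnatr_eq0.
pose v i j := if i is i'.+1 then z j ^+ i' * (1 - z j) ^+ b.+1 else 1.
transitivity (\det (\matrix_(i < l, j < l) (v i.+1 j.+1 - v i.+1 j))).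
  by congr (\det _); apply/matrixP => i j; rewrite !mxE !hornerE.
rewrite det_differences// (@det_border_last_col _ _ _ 1); last first.
  by case=> [|i] /=; rewrite ?mulr1// zl subrr exprS mul0r mulr0.
rewrite mulr1; congr (_ * _); rewrite jacobi_detE; congr (\det _).
by apply/matrixP => i j; rewrite !mxE /= expr0 mul1r.
Qed.

(** The [F i] with [i > 0] vanish at both ends. The derivative of [F 0] is the weight itself, so
    [F0] is only normalized at 0, and its value at 1, a beta integral, enters the constant. Both end
    columns drop out, hence the size falls to [l]. *)
Lemma interlacing_step_zero_one l a b :
  interlacing_step l.+1 a b (fun z => z 0%N = 0 /\ z l.+1 = 1)
    (fun z => jacobi_det l a.+1 b.+1 (fun j => z j.+1)).
Proof.
have [F0 dF0 F00] := antiderivative_poly ('X ^+ a * (1 - 'X) ^+ b : {poly R}).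
pose q i : {poly R} := if i is i'.+1 then
  (a.+1 + i')%:R *: 'X^i' - (a.+1 + b.+1 + i')%:R *: 'X^i else 1.
pose F i := if i is i'.+1 then 'X^(a.+1 + i') * (1 - 'X) ^+ b.+1 else F0.
exists F, (\prod_(i < l.+1) (q i)`_i)^-1, ((-1) ^+ l * F0.[1]).
split=> [y|z [z0 zl]].
  apply: (@jacobi_det_graded _ _ _ _ (fun i => (F i)^`()) q) => i.
  - case: i => [|i] /=; first by rewrite mul1r.
    rewrite derivM derivXn deriv_exp derivB derivX derivC sub0r.
    rewrite addSn /= -!mul_polyC !polyC_natr !exprS exprD; ring.
  - case: i => [|i] /=; first by rewrite size_poly1.
    apply/leq_sizeP => j ij; rewrite coefB !coefZ !coefXn.
    by rewrite !gtn_eqF ?mulr0 ?subr0// ltnW.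
  - case: i => [|i] /=; first by rewrite coef1 oner_neq0.
    rewrite coefB !coefZ !coefXn eqxx gtn_eqF// mulr0 sub0r mulr1.
    by rewrite oppr_eq0 pnatr_eq0.
pose v i j := if i is i'.+1 then (F i').[z j] else 1.
transitivity (\det (\matrix_(i < l.+1, j < l.+1) (v i.+1 j.+1 - v i.+1 j))).
  by congr (\det _); apply/matrixP => i j; rewrite !mxE.
rewrite det_differences// det_border_first_col; last first.
  by case=> //= -[|i] /=; rewrite z0// !hornerE addSn expr0n mul0r.
rewrite (@det_border_last_col _ _ (fun i j => v i.+1 j.+1) F0.[1]); last first.
  by case=> [|i] /=; rewrite zl ?mul1r// !hornerE subrr exprS !mul0r mulr0.
congr (_ * _); rewrite jacobi_detE; congr (\det _).
by apply/matrixP => i j; rewrite !mxE /= !hornerE exprD; congr (_ * _); rewrite mulrC.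
Qed.

(** The constant is chosen before the box, the outer factor [K] and the integrand; this uniformity
    lets the constants of successive diagonals be multiplied. *)
Lemma iint_interlacing_step l a b P t : interlacing_step l a b P t ->
  exists C : R, forall (N : nat) (c : nat -> nat) z (bl br : nat -> bool) (K : R)
    (f : N.-tuple R -> \bar R) (y : N.-tuple R),
  P z -> (forall j, (j < l)%N -> z j <= z j.+1) ->
  {in gtn l &, injective c} -> (forall j, (j < l)%N -> (c j < N)%N) ->
  (forall w : N.-tuple R, (forall k, k \notin mkseq c l -> w`_k = y`_k) ->
    f w = (K * (\prod_(j < l) (w`_(c j) \in
        Interval (BSide (bl j) (z j)) (BSide (br j) (z j.+1)))%:R) *
      jacobi_det l a b (fun j => w`_(c j)))%:E) ->
  iint (mkseq c l) f y = (C * K * t z)%:E.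
Proof.
move=> [F [C1 [C2 [FE FzE]]]]; exists (C1 * C2) => N c z bl br K f y Pz zle ci cN fE.
rewrite (iint_box_det (F := F) (K := K * C1) (bl := bl) (br := br) zle ci cN) => [|w wE].
  by rewrite FzE//; congr EFin; ring.
by rewrite fE// FE; congr EFin; rewrite -!mulrA; congr (_ * _); rewrite mulrCA.
Qed.

End interlacing_steps.

(** * Diagonals of the rectangle *)

Section diagonals.
Variables m n : nat.
Hypotheses (m_gt0 : (0 < m)%N) (ltmn : (m < n)%N).

(* Diagonal t consists of the entries (i, j), counted from 0, with
   j - i = t - (m - 1); it starts at (diag_row t, diag_col t). *)
Definition diag_row t := (m.-1 - t)%N.
Definition diag_col t := (t - m.-1)%N.
Definition diag_len t := minn (m - diag_row t) (n - diag_col t).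
Definition diag_cell t p := ((diag_row t + p) * n + (diag_col t + p))%N.
Definition last_diag := (m + n).-2.
Definition diag_cells t := mkseq (diag_cell t) (diag_len t).
Definition diag_of k := ((m.-1 - k %/ n) + k %% n)%N.

(** The head of a list is the outermost variable of [iint]: here diagonal 0 is integrated first, and
    in [upper_cells] the diagonal [last_diag] is. *)
Fixpoint lower_cells s :=
  if s is s'.+1 then diag_cells s' ++ lower_cells s' else [::].

Fixpoint upper_cells k :=
  if k is k'.+1 then diag_cells (last_diag - k') ++ upper_cells k' else [::].

Lemma divn_modn_cell i j : (j < n)%N ->
  (((i * n + j) %/ n)%N = i) * (((i * n + j) %% n)%N = j).
Proof.
move=> jn; rewrite modnMDl modn_small// divnMDl ?divn_small ?addn0//.
exact: leq_ltn_trans jn.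
Qed.

Lemma diag_lenE t : (t <= last_diag)%N ->
  diag_len t = if (t < m.-1)%N then t.+1 else minn m (n + m.-1 - t).
Proof. by rewrite /last_diag /diag_len /diag_row /diag_col; case: ifP; lia. Qed.

Lemma diag_cell_bounds t p : (t <= last_diag)%N -> (p < diag_len t)%N ->
  (diag_row t + p < m)%N /\ (diag_col t + p < n)%N.
Proof. by rewrite /diag_len leq_min => _ /andP[]; lia. Qed.

Lemma diag_cell_lt t p : (t <= last_diag)%N -> (p < diag_len t)%N ->
  (diag_cell t p < m * n)%N.
Proof.
move=> tT /(diag_cell_bounds tT)[im jn]; rewrite /diag_cell.
by apply: (@leq_trans ((diag_row t + p).+1 * n)); [rewrite mulSn; lia|rewrite leq_mul2r im orbT].
Qed.

Lemma diag_of_cell t p : (t <= last_diag)%N -> (p < diag_len t)%N ->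
  diag_of (diag_cell t p) = t.
Proof.
move=> tT pt; have [im jn] := diag_cell_bounds tT pt.
rewrite /diag_of /diag_cell !divn_modn_cell//.
by move: im jn; rewrite /diag_row /diag_col; lia.
Qed.

Lemma mem_diag_cells t k : (t <= last_diag)%N ->
  (k \in diag_cells t) = (k < m * n)%N && (diag_of k == t).
Proof.
move=> tT; apply/idP/idP.
  move=> /mapP[p]; rewrite mem_iota add0n => /= pt ->.
  by rewrite diag_cell_lt// diag_of_cell ?eqxx.
move=> /andP[kN /eqP kt].
have n0 : (0 < n)%N by lia.
have kn : (k %% n < n)%N by rewrite ltn_mod.
have km : (k %/ n < m)%N by rewrite ltn_divLR.
apply/mapP; exists (k %/ n - diag_row t)%N; last first.
  rewrite [LHS](divn_eq k n) /diag_cell; move: kt km kn.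
  rewrite /diag_of /diag_row /diag_col; move: (k %/ n)%N (k %% n)%N => i j *.
  by congr (_ * _ + _)%N; lia.
rewrite mem_iota add0n; move: kt km kn.
rewrite /diag_of /diag_len /diag_row /diag_col.
by move: (k %/ n)%N (k %% n)%N => i j; lia.
Qed.

Lemma diag_cell_inj t : {in gtn (diag_len t) &, injective (diag_cell t)}.
Proof.
move=> p q; rewrite !inE /diag_len !leq_min => /andP[_ pt] /andP[_ qt] pq.
have := congr1 (modn^~ n) pq; rewrite /diag_cell !divn_modn_cell; lia.
Qed.

Lemma uniq_diag_cells t : uniq (diag_cells t).
Proof.
rewrite map_inj_in_uniq ?iota_uniq// => p q.
by rewrite !mem_iota !add0n /= => pt qt; exact: diag_cell_inj.
Qed.

Lemma diag_of_le k : (k < m * n)%N -> (diag_of k <= last_diag)%N.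
Proof.
move=> kN; have kn : (k %% n < n)%N by rewrite ltn_mod; lia.
move: kn; rewrite /diag_of /last_diag; move: (k %/ n)%N (k %% n)%N => i j; lia.
Qed.

Lemma mem_lower_cells s k : (s <= last_diag.+1)%N ->
  (k \in lower_cells s) = (k < m * n)%N && (diag_of k < s)%N.
Proof.
elim: s => [|s IH] sT /=; first by rewrite ltn0 andbF.
rewrite mem_cat mem_diag_cells// (IH (ltnW sT)).
by case: (k < m * n)%N => //=; rewrite ltnS [RHS]leq_eqVlt.
Qed.

Lemma uniq_lower_cells s : (s <= last_diag.+1)%N -> uniq (lower_cells s).
Proof.
elim: s => //= s IH sT; rewrite cat_uniq uniq_diag_cells (IH (ltnW sT)) andbT /=.
apply/hasPn => k; rewrite mem_lower_cells ?(ltnW sT)//= mem_diag_cells//.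
by move=> /andP[_ ks]; rewrite (ltn_eqF ks) andbF.
Qed.

Lemma mem_upper_cells c k : (c <= last_diag.+1)%N ->
  (k \in upper_cells c) = (k < m * n)%N && (last_diag < diag_of k + c)%N.
Proof.
elim: c => [|c IH] cT /=.
  case: (ltnP k (m * n)) => //= /diag_of_le kT.
  by rewrite addn0 ltnNge kT.
rewrite mem_cat mem_diag_cells ?leq_subr// (IH (ltnW cT)).
by case: (k < m * n)%N => //=; lia.
Qed.

Lemma uniq_upper_cells c : (c <= last_diag.+1)%N -> uniq (upper_cells c).
Proof.
elim: c => //= c IH cT; rewrite cat_uniq uniq_diag_cells (IH (ltnW cT)) andbT /=.
apply/hasPn => k; rewrite mem_upper_cells ?(ltnW cT)//= mem_diag_cells ?leq_subr//.
by move=> /andP[_ ks]; case: (k < m * n)%N => //=; lia.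
Qed.

(** Diagonal [s] is placed outermost, so that both sides are integrated for fixed values on it. *)
Lemma perm_cells s : (s <= last_diag)%N ->
  perm_eq (iota 0 (m * n))
    (diag_cells s ++ upper_cells (last_diag - s) ++ lower_cells s).
Proof.
move=> sT.
have mD k : (k \in diag_cells s) = (k < m * n)%N && (diag_of k == s).
  exact: mem_diag_cells.
have mU k : (k \in upper_cells (last_diag - s)) = (k < m * n)%N && (s < diag_of k)%N.
  by rewrite mem_upper_cells; [congr (_ && _); lia|lia].
have mL k : (k \in lower_cells s) = (k < m * n)%N && (diag_of k < s)%N.
  by rewrite mem_lower_cells// ltnW.
apply: uniq_perm; first exact: iota_uniq.
  rewrite !cat_uniq uniq_diag_cells uniq_upper_cells; last lia.
  rewrite uniq_lower_cells; last lia.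
  rewrite has_cat negb_or !andbT /=; rewrite -andbA; apply/and3P; split; apply/hasPn => k /=;
    rewrite ?mU ?mD ?mL; case: (k < m * n)%N => //=; lia.
move=> k; rewrite !mem_cat mem_iota mU mD mL add0n /=.
by case: (k < m * n)%N => //=; lia.
Qed.

End diagonals.

(** * Integration of one diagonal together with the remaining constraints *)

Section strip.
Context (R : realType).
Implicit Types (x z : nat -> R).

Definition nondec l x := forall p, (p.+1 < l)%N -> x p <= x p.+1.

Lemma eq_jacobi_det l a b x x' : (forall p, (p < l)%N -> x p = x' p) ->
  jacobi_det l a b x = jacobi_det l a b x'.
Proof.
move=> xx'; rewrite !jacobi_detE; congr (\det _).
by apply/matrixP => i j; rewrite !mxE xx'.
Qed.

Lemma jacobi_det1 x : jacobi_det 1 0 0 x = 1.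
Proof. by rewrite jacobi_detE det_mx11 mxE !expr0 !mulr1. Qed.

Lemma iint_eq0 N (s : seq nat) (f : N.-tuple R -> \bar R) (y : N.-tuple R) :
  (forall w : N.-tuple R, (forall k, k \notin s -> w`_k = y`_k) -> f w = 0%E) ->
  iint s f y = 0%E.
Proof.
move=> f0; rewrite (@eq_iint _ _ _ _ (fun=> 0%E))//.
elim: s y {f f0} => //= k s IH y.
by rewrite integral0_eq.
Qed.

(* Q is the constraint on all remaining entries, Q' what is left of it once the
   entries c p are removed; I' says that z is nondecreasing, which is not part of Q'
   but is forced by Q. *)
Lemma iint_strip l a b P t : @interlacing_step R l a b P t ->
  exists C : R, forall (N : nat) (c : nat -> nat) z (bl br : nat -> bool) (K : R)
    (f : N.-tuple R -> \bar R) (y : N.-tuple R)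
    (Q : N.-tuple R -> Prop) (Q' I' : Prop),
  P z -> {in gtn l &, injective c} -> (forall j, (j < l)%N -> (c j < N)%N) ->
  (forall w : N.-tuple R, (forall k, k \notin mkseq c l -> w`_k = y`_k) -> 
    (Q w <-> Q' /\ forall p, (p < l)%N -> w`_(c p) \in
        Interval (BSide (bl p) (z p)) (BSide (br p) (z p.+1)))) ->
  (Q' -> (I' <-> nondec l.+1 z)) ->
  (forall w : N.-tuple R, (forall k, k \notin mkseq c l -> w`_k = y`_k) ->
    f w = (K * `[< Q w >]%:R * `[< nondec l (fun j => w`_(c j)) >]%:R *
      jacobi_det l a b (fun j => w`_(c j)))%:E) ->
  iint (mkseq c l) f y = (C * K * `[< Q' >]%:R * `[< I' >]%:R * t z)%:E.
Proof.
move=> /iint_interlacing_step[C HC]; exists C => N c z bl br K f y Q Q' I' Pz ci cN QE IE fE.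
(* Consecutive boxes share an endpoint, so these inequalities force both [z] and the integrated
   entries to be nondecreasing. *)
have box_le w : (forall p, (p < l)%N -> w p \in
    Interval (BSide (bl p) (z p)) (BSide (br p) (z p.+1))) ->
    forall p, (p < l)%N -> z p <= w p <= z p.+1.
  by move=> wI p /wI; rewrite itv_boundlr => /andP[/lteifW -> /lteifW ->].
have [Q't|Q'f] := pselect Q'; last first.
  rewrite (asboolF Q'f) mulr0 !mul0r iint_eq0// => w wy.
  by rewrite fE// asboolF ?mulr0 ?mul0r// => /(QE _ wy)[].
have [I't|I'f] := pselect I'; last first.
  rewrite (asboolF I'f) mulr0 mul0r iint_eq0// => w wy.
  rewrite fE// asboolF ?mulr0 ?mul0r// => /(QE _ wy)[_ wI].
  apply: I'f; apply/(IE Q't) => p; rewrite ltnS => pl.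
  by have /andP[] := box_le (fun p => w`_(c p)) wI _ pl; exact: le_trans.
rewrite (asboolT Q't) (asboolT I't) !mulr1.
apply: (HC _ _ _ bl br) => //.
  by move=> j jl; move/(IE Q't): I't; apply.
move=> w wy; rewrite fE//; congr (_ * _)%:E; rewrite -mulrA; congr (_ * _).
(* Inside the box both indicators are 1, and outside it [Q] fails: together they are the indicator
   of the box. *)
have [wI|wI] := pselect (forall p, (p < l)%N -> w`_(c p) \in
    Interval (BSide (bl p) (z p)) (BSide (br p) (z p.+1))).
  rewrite asboolT ?mul1r; last exact/(QE _ wy).
  rewrite asboolT; last first.
    move=> p pl; have /andP[_ h1] := box_le (fun p => w`_(c p)) wI _ (ltnW pl).
    by have /andP[+ _] := box_le (fun p => w`_(c p)) wI _ pl; exact: le_trans.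
  by rewrite big1// => j _; rewrite wI.
rewrite asboolF ?mul0r; last by move=> /(QE _ wy)[].
move/existsNP : wI => [p /not_implyP[pl /negP/negPf wp]].
by rewrite (bigD1 (Ordinal pl))//= wp mul0r.
Qed.

End strip.

(** * The array inequalities as interlacing of consecutive diagonals *)

Section diagonal_constraints.
Context (R : realType).
Variables m n : nat.
Hypotheses (m_gt0 : (0 < m)%N) (ltmn : (m < n)%N).

Local Notation cell := (diag_cell m n).
Local Notation len := (diag_len m n).
Local Notation top := (last_diag m n).
Implicit Types (y w : (m * n).-tuple R) (t u p : nat).

Definition diag_entry t y p : R := y`_(cell t p).

(* Entry p of diagonal t is confined by diagonal t.+1 to an interval with
   endpoints lower_point p and lower_point p.+1; the bounds 0 and 1 replace the
   missing neighbours, and only there is the interval closed. *)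
Definition lower_point t y p : R :=
  if (t < m.-1)%N then diag_entry t.+1 y p
  else if p is q.+1 then
    if (q < len t.+1)%N then diag_entry t.+1 y q else 1
  else 0.

Definition lower_left_closed t p := ((m.-1 <= t) && (p == 0))%N.
Definition lower_right_open t p := ((t < m.-1) || (p < len t.+1))%N.

Definition lower_box t y p := Interval
  (BSide (lower_left_closed t p) (lower_point t y p))
  (BSide (lower_right_open t p) (lower_point t y p.+1)).

(* The same for entry p of diagonal t.+1, confined by diagonal t when m.-1 <= t. *)
Definition upper_point t y p : R :=
  if (p < len t)%N then diag_entry t y p else 1.

Definition upper_right_open t p := (p.+1 < len t)%N.

Definition upper_box t y p := Interval (BSide false (upper_point t y p))
  (BSide (upper_right_open t p) (upper_point t y p.+1)).

(** Each pair of consecutive diagonals is recorded once, as a condition on the lower one;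
    [between_diags_upper] converts it when the upper one is to be removed. *)
Definition between_diags s t y :=
  (forall u p, (s <= u <= t)%N -> (p < len u)%N -> 0 <= diag_entry u y p <= 1) /\
  (forall u p, (s <= u < t)%N -> (p < len u)%N ->
    diag_entry u y p \in lower_box u y p).

Lemma diag_len_grow t : (t < m.-1)%N -> (len t.+1 = (len t).+1)%N.
Proof.
move=> tm; have tT : (t.+1 <= top)%N by rewrite /last_diag; lia.
by rewrite !diag_lenE ?(ltnW tT)// tm; case: ifP => //; lia.
Qed.

Lemma diag_len_same t : (m.-1 <= t)%N -> (t.+1 < n)%N -> (len t = m) * (len t.+1 = m).
Proof.
move=> tm tn; have tT : (t.+1 <= top)%N by rewrite /last_diag; lia.
by rewrite !diag_lenE ?(ltnW tT)// !ltnNge tm (leqW tm) /=; split; lia.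
Qed.

Lemma diag_len_shrink t : (t < top)%N -> (n <= t.+1)%N -> (len t = (len t.+1).+1)%N.
Proof.
move=> tT tn; have tm : (m.-1 <= t)%N by lia.
rewrite !diag_lenE ?(ltnW tT)// !ltnNge tm (leqW tm) /=.
by move: tT; rewrite /last_diag; lia.
Qed.

Lemma diag_len_bounds t : (t < top)%N -> (m.-1 <= t)%N ->
  (len t.+1 <= len t <= (len t.+1).+1)%N.
Proof.
move=> tT tm; have [tn|nt] := ltnP t.+1 n; last by rewrite (diag_len_shrink tT nt); lia.
by rewrite !(diag_len_same tm tn); lia.
Qed.

(** The point is the range condition on diagonal [s]: it follows from the box, whose endpoints lie
    in [0, 1]. *)
Lemma between_diags_lower s t y : (s < t)%N -> (t <= top)%N ->
  between_diags s t y <-> between_diags s.+1 t y /\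
    forall p, (p < len s)%N -> diag_entry s y p \in lower_box s y p.
Proof.
move=> st tT; split=> [[Q1 Q2]|[[Q1 Q2] Q3]].
  split; first split=> u p /andP[su ut]; [apply: Q1|apply: Q2|]; rewrite ?(ltnW su)//.
  by move=> p; apply: Q2; rewrite leqnn.
have Q2' u p : (s <= u < t)%N -> (p < len u)%N -> diag_entry u y p \in lower_box u y p.
  move=> /andP[]; rewrite leq_eqVlt => /predU1P[<- _|su ut]; first exact: Q3.
  by apply: Q2; rewrite su.
split=> // u p /andP[]; rewrite leq_eqVlt => /predU1P[<- _ ps|su ut]; last first.
  by apply: Q1; rewrite su.
have Q01 q : (q < len s.+1)%N -> 0 <= diag_entry s.+1 y q <= 1.
  by apply: Q1; rewrite leqnn.
have z01 q : (q <= len s)%N -> 0 <= lower_point s y q <= 1.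
  rewrite /lower_point; case: ifPn => [sm ql|_]; first by rewrite Q01// diag_len_grow.
  case: q => [_|q ql]; first by rewrite lexx ler01.
  by case: ifP => [|_]; [exact: Q01|rewrite ler01 lexx].
have := Q3 _ ps; rewrite itv_boundlr => /andP[/lteifW lo /lteifW hi].
have /andP[h1 _] := z01 _ (ltnW ps); have /andP[_ h2] := z01 _ ps.
by rewrite (le_trans h1 lo) (le_trans hi h2).
Qed.

(** From diagonal [m.-1] on, entry [p] of diagonal [t.+1] lies between entries [p] and [p.+1] of
    diagonal [t], the bound 1 replacing a missing entry; the interlacing can be read from either
    side. *)
Lemma between_diags_upper s t y : (s <= t)%N -> (t < top)%N -> (m.-1 <= t)%N ->
  between_diags s t.+1 y <-> between_diags s t y /\
    forall p, (p < len t.+1)%N -> diag_entry t.+1 y p \in upper_box t y p.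
Proof.
move=> st tT mt; have /andP[l1 l2] := diag_len_bounds tT mt.
have tmF : (t < m.-1)%N = false by rewrite ltnNge mt.
split=> [[Q1 Q2]|[[Q1 Q2] Q3]].
  split; first split=> u p /andP[su ut]; [apply: Q1|apply: Q2|];
    rewrite ?su ?ltnS ?(ltnW ut)// ?leqW//.
  move=> p pl.
  have tt : (s <= t < t.+1)%N by rewrite st leqnn.
  have pl' : (p < len t)%N by exact: leq_trans pl l1.
  have := Q2 t p tt pl'; rewrite !itv_boundlr /= => /andP[_].
  rewrite /lower_point /lower_right_open /upper_right_open /upper_point tmF /= pl pl' /=.
  rewrite !bnd_simp => ->/=.
  case: ifP => [pl1|_].
    have := Q2 t p.+1 tt pl1; rewrite !itv_boundlr /= => /andP[+ _].
    rewrite /lower_point /lower_left_closed tmF pl andbF.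
    by rewrite !bnd_simp.
  have tt1 : (s <= t.+1 <= t.+1)%N by rewrite leqW/=.
  by have /andP[_] := Q1 t.+1 p tt1 pl; rewrite !bnd_simp.
have Q01 q : (q < len t)%N -> 0 <= diag_entry t y q <= 1.
  by apply: Q1; rewrite st leqnn.
split=> u p /andP[su].
  rewrite leq_eqVlt => /predU1P[->|ut] pl; last by apply: Q1 => //; rewrite su.
  have := Q3 p pl; rewrite itv_boundlr => /andP[/lteifW /= lo /lteifW /= hi].
  move: lo hi; rewrite /upper_point (leq_trans pl l1) => lo hi.
  have /andP[h _] := Q01 _ (leq_trans pl l1); rewrite (le_trans h lo) (le_trans hi)//.
  by case: ifP => [/Q01/andP[]|].
rewrite ltnS leq_eqVlt => /predU1P[->|ut] pl; last by apply: Q2 => //; rewrite su.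
rewrite itv_boundlr /= /lower_point /lower_left_closed /lower_right_open tmF mt /=.
apply/andP; split.
  case: p pl => [|p] pl /=; first by rewrite bnd_simp; have /andP[] := Q01 _ pl.
  have pl1 : (p < len t.+1)%N by rewrite -ltnS (leq_trans pl).
  have := Q3 p pl1; rewrite pl1 itv_boundlr /= => /andP[_].
  by rewrite /upper_right_open /upper_point pl !bnd_simp.
case: ifP => pl1; last by rewrite bnd_simp; have /andP[] := Q01 _ pl.
have := Q3 p pl1; rewrite itv_boundlr /= => /andP[+ _].
by rewrite /upper_point pl !bnd_simp.
Qed.

End diagonal_constraints.

(** * Integrating out all diagonals on one side *)

Section diagonal_integration.
Context (R : realType).
Variables m n : nat.
Hypotheses (m_gt0 : (0 < m)%N) (ltmn : (m < n)%N).

Local Notation cell := (diag_cell m n).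
Local Notation len := (diag_len m n).
Local Notation top := (last_diag m n).
Local Notation D := (@diag_entry R m n).
Local Notation cells := (diag_cells m n).
Implicit Types (y w : (m * n).-tuple R) (s t u p : nat).

(* The exponents produced after the removal of all diagonals below t (low_a, low_b)
   and of all diagonals above t (up_b). *)
Definition low_a t := (t - m.-1)%N.
Definition low_b t := (t - n.-1)%N.
Definition up_b t := (n.-1 - t)%N.

(** Three regimes: no boundary endpoint while the diagonals grow, the endpoint 0 while their length
    is [m], both 0 and 1 while they shrink. Truncated subtraction starts each exponent at the right
    diagonal. *)
Lemma lower_step s : (s < top)%N -> exists P f,
  interlacing_step (len s) (low_a s) (low_b s) P f /\
  forall y, P (lower_point s y) /\
    f (lower_point s y) =
      jacobi_det (len s.+1) (low_a s.+1) (low_b s.+1) (D s.+1 y).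
Proof.
move=> sT; rewrite /low_a /low_b.
have [sm|ms] := ltnP s m.-1.
  have -> : (s - m.-1 = 0)%N by lia.
  have -> : (s.+1 - m.-1 = 0)%N by lia.
  have -> : (s - n.-1 = 0)%N by lia.
  have -> : (s.+1 - n.-1 = 0)%N by lia.
  exists (fun=> True), (jacobi_det (len s).+1 0 0).
  split; first exact: interlacing_step_grow.
  move=> y; split=> //; rewrite diag_len_grow//.
  by apply: eq_jacobi_det => p _; rewrite /lower_point sm.
have smF : (s < m.-1)%N = false by rewrite ltnNge ms.
have -> : (s.+1 - m.-1 = (s - m.-1).+1)%N by lia.
have [sn|ns] := ltnP s.+1 n.
  have -> : (s - n.-1 = 0)%N by lia.
  have -> : (s.+1 - n.-1 = 0)%N by lia.
  eexists; eexists; split; first exact: interlacing_step_zero.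
  move=> y /=; rewrite /lower_point smF; split=> //.
  rewrite !(diag_len_same m_gt0 ltmn ms sn).
  by apply: eq_jacobi_det => p ->.
have -> : (s.+1 - n.-1 = (s - n.-1).+1)%N by lia.
have ls : (len s = (len s.+1).+1)%N by exact: diag_len_shrink.
rewrite ls.
eexists; eexists; split; first exact: interlacing_step_zero_one.
move=> y /=; rewrite /lower_point smF ltnn; split=> //.
by apply: eq_jacobi_det => p ->.
Qed.

(** Seen from the corner (1, n), the diagonals first grow without a boundary endpoint, then keep
    length [m] with the endpoint 1; 0 never occurs, so the exponent of [x] stays 0. *)
Lemma upper_step t : (t < top)%N -> (m.-1 <= t)%N -> exists P f,
  interlacing_step (len t.+1) 0 (up_b t.+1) P f /\
  forall y, P (upper_point t y) /\
    f (upper_point t y) = jacobi_det (len t) 0 (up_b t) (D t y).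
Proof.
move=> tT mt; rewrite /up_b; have [tn|nt] := ltnP t.+1 n.
  have -> : (n.-1 - t = (n.-1 - t.+1).+1)%N by lia.
  eexists; eexists; split; first exact: interlacing_step_one.
  move=> y /=; rewrite /upper_point !(diag_len_same m_gt0 ltmn mt tn) ltnn; split=> //.
  by apply: eq_jacobi_det => p ->.
have -> : (n.-1 - t.+1 = 0)%N by lia.
have -> : (n.-1 - t = 0)%N by lia.
have -> : (len t = (len t.+1).+1)%N by exact: diag_len_shrink.
eexists; eexists; split; first exact: interlacing_step_grow.
move=> y; split=> //; apply: eq_jacobi_det => p pl.
by rewrite /upper_point (diag_len_shrink m_gt0 ltmn tT nt) pl.
Qed.

Lemma eq_lower_point s y w p : (s < top)%N -> (p <= len s)%N ->
  (forall q, (q < len s.+1)%N -> D s.+1 w q = D s.+1 y q) ->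
  lower_point s w p = lower_point s y p.
Proof.
move=> sT ps wy; rewrite /lower_point; case: ifPn => [sm|_].
  by rewrite wy// diag_len_grow.
by case: p ps => // p _; case: ifP => // /wy.
Qed.

Lemma eq_upper_point t y w : (forall q, (q < len t)%N -> D t w q = D t y q) ->
  upper_point t w =1 upper_point t y.
Proof. by move=> wy p; rewrite /upper_point; case: ifP => // /wy. Qed.

Lemma eq_between_diags s t y w : (t <= top)%N ->
  (forall u p, (s <= u <= t)%N -> (p < len u)%N -> D u w p = D u y p) ->
  between_diags s t w <-> between_diags s t y.
Proof.
move=> tT.
suff imp y' w' : (forall u p, (s <= u <= t)%N -> (p < len u)%N -> D u w' p = D u y' p) ->
    between_diags s t w' -> between_diags s t y'.
  by move=> wy; split; apply: imp => // u p su pu; rewrite wy.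
move=> wy [Q1 Q2]; split=> u p sut pu; first by rewrite -wy//; exact: Q1.
have /andP[su ut] := sut.
have sut1 : (s <= u <= t)%N by rewrite su ltnW.
have eqD q : (q < len u.+1)%N -> D u.+1 w' q = D u.+1 y' q.
  by move=> ql; rewrite wy// ut leqW.
have uT : (u < top)%N by exact: leq_trans tT.
have := Q2 u p sut pu; rewrite wy// /lower_box.
by rewrite (eq_lower_point uT (ltnW pu) eqD) (eq_lower_point uT pu eqD).
Qed.

Lemma diag_entry_off t u y w p : (t <= top)%N -> (u <= top)%N -> u != t ->
  (p < len u)%N -> (forall k, k \notin cells t -> w`_k = y`_k) ->
  D u w p = D u y p.
Proof.
move=> tT uT ut pu; rewrite /diag_entry; apply.
by rewrite mem_diag_cells// diag_of_cell// (negPf ut) andbF.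
Qed.

Lemma lower_point_nondec s y : (s < top)%N ->
  (forall p, (p < len s.+1)%N -> 0 <= D s.+1 y p <= 1) ->
  nondec (len s.+1) (D s.+1 y) <-> nondec (len s).+1 (lower_point s y).
Proof.
move=> sT D01; rewrite /nondec /lower_point.
have [sm|ms] := ltnP s m.-1; first by rewrite diag_len_grow.
have /andP[l1 l2] := diag_len_bounds m_gt0 ltmn sT ms.
split=> [inc p|inc p pl].
  rewrite ltnS => pl; case: ifPn => pl1.
    case: p pl pl1 => [|p] pl pl1; first by have /andP[] := D01 _ pl1.
    by rewrite (ltnW pl1); exact: inc.
  case: p pl pl1 => // p pl pl1; case: ifP => // pl2.
  by have /andP[] := D01 _ pl2.
have := inc p.+1; rewrite ltnS pl (ltnW pl); apply.
exact: leq_trans l1.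
Qed.

Lemma upper_point_nondec t y : (t < top)%N -> (m.-1 <= t)%N ->
  (forall p, (p < len t)%N -> 0 <= D t y p <= 1) ->
  nondec (len t) (D t y) <-> nondec (len t.+1).+1 (upper_point t y).
Proof.
move=> tT mt D01; rewrite /nondec /upper_point.
have /andP[l1 l2] := diag_len_bounds m_gt0 ltmn tT mt.
split=> [inc p|inc p pl].
  rewrite ltnS => pl; rewrite (leq_trans pl l1); case: ifP => [/inc//|_].
  by have /andP[] := D01 _ (leq_trans pl l1).
have := inc p; rewrite pl (ltnW pl); apply.
exact: leq_trans l2.
Qed.

(** For factors carried along unchanged: the indicator of an event on the chosen diagonal, and later
    the outcome of the integration below it. *)
Definition on_diag s (h : (m * n).-tuple R -> R) :=
  forall y w, (forall p, (p < len s)%N -> D s w p = D s y p) -> h w = h y.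

Lemma iint_lower_cells s : (s <= top)%N -> exists C : R,
  forall S h, (s <= S <= top)%N -> on_diag S h -> forall y,
  iint (lower_cells m n s) (fun w => (h w * `[< between_diags 0 top w >]%:R)%:E) y =
  (C * h y * `[< between_diags s top y >]%:R * `[< nondec (len s) (D s y) >]%:R *
    jacobi_det (len s) (low_a s) (low_b s) (D s y))%:E.
Proof.
elim: s => [_|s IH sT].
  (* Diagonal 0 is the single corner cell (m, 1), with weight 1. *)
  exists 1 => S h _ _ y /=.
  have -> : len 0 = 1%N by rewrite diag_lenE//; case: ifP => //; lia.
  rewrite /low_a /low_b !sub0n jacobi_det1 mulr1 mul1r.
  have nd : nondec 1 (D 0 y) by [].
  by rewrite (asboolT nd) mulr1.
have [C1 IHC] := IH (ltnW sT).
have [P [f [/iint_strip[C2 HC] Pf]]] := lower_step sT.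
exists (C2 * C1) => S h /andP[sS ST] hS y /=.
have off u w p : (u <= top)%N -> u != s -> (p < len u)%N ->
    (forall k, k \notin cells s -> w`_k = y`_k) -> D u w p = D u y p.
  by move=> uT us pu wy; apply: (diag_entry_off (ltnW sT) uT us pu wy).
have [Py fy] := Pf y.
rewrite iint_cat.
rewrite (HC _ _ _ (lower_left_closed m s) (lower_right_open m n s) (C1 * h y) _ y
  (between_diags s top) (between_diags s.+1 top y)
  (nondec (len s.+1) (D s.+1 y)) Py) ?fy ?mulrA//.
- exact: diag_cell_inj.
- by move=> j; apply: diag_cell_lt => //; exact: ltnW.
- move=> w wy; rewrite between_diags_lower//.
  have eqD q : (q < len s.+1)%N -> D s.+1 w q = D s.+1 y q.
    by move=> ql; apply: off; rewrite // gtn_eqF.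
  rewrite (@eq_between_diags s.+1 top y w)//; last first.
    by move=> u p /andP[su uT] pu; apply: off; rewrite // gtn_eqF.
  split=> -[Q1 Q2]; split=> // p ps; have := Q2 p ps; rewrite /lower_box;
    by rewrite (eq_lower_point sT (ltnW ps) eqD) (eq_lower_point sT ps eqD).
- move=> [Q1 _]; apply: lower_point_nondec => // p pl.
  by apply: Q1; rewrite ?leqnn.
- move=> w wy; rewrite (IHC S h) ?(ltnW sS)// (hS y w)// => p pS.
  by apply: off; rewrite // gtn_eqF.
Qed.

(** The counterpart of [iint_lower_cells] from the corner (1, n), applied when the diagonals below
    [S] are already gone. *)
Lemma iint_upper_cells c : (c <= top - m.-1)%N -> exists C : R,
  forall S h, (m.-1 <= S <= top - c)%N -> on_diag S h -> forall y,
  iint (upper_cells m n c) (fun w => (h w * `[< between_diags S top w >]%:R)%:E) y =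
  (C * h y * `[< between_diags S (top - c) y >]%:R *
    `[< nondec (len (top - c)) (D (top - c) y) >]%:R *
    jacobi_det (len (top - c)) 0 (up_b (top - c)) (D (top - c) y))%:E.
Proof.
elim: c => [_|c IH cT].
  exists 1 => S h _ _ y /=; rewrite subn0.
  have -> : len top = 1%N.
    by rewrite diag_lenE//; case: ifP; rewrite /last_diag; lia.
  have -> : up_b top = 0%N by rewrite /up_b /last_diag; lia.
  have nd : nondec 1 (D top y) by [].
  by rewrite jacobi_det1 mulr1 mul1r (asboolT nd) mulr1.
have [C1 IHC] := IH (ltnW cT).
have tc : (top - c = (top - c.+1).+1)%N by lia.
rewrite tc in IHC; set t := (top - c.+1)%N in IHC tc *.
have tT : (t < top)%N by rewrite /t; lia.
have mt : (m.-1 <= t)%N by rewrite /t; lia.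
have [P [f [/iint_strip[C2 HC] Pf]]] := upper_step tT mt.
exists (C2 * C1) => S h /andP[mS St] hS y /=.
have off u w p : (u <= top)%N -> u != t.+1 -> (p < len u)%N ->
    (forall k, k \notin cells t.+1 -> w`_k = y`_k) -> D u w p = D u y p.
  by move=> uT us pu wy; apply: (diag_entry_off tT uT us pu wy).
have [Py fy] := Pf y.
rewrite iint_cat tc.
rewrite (HC _ _ _ (fun=> false) (upper_right_open m n t) (C1 * h y) _ y
  (between_diags S t.+1) (between_diags S t y)
  (nondec (len t) (D t y)) Py) ?fy ?mulrA//.
- exact: diag_cell_inj.
- by move=> j; apply: diag_cell_lt.
- move=> w wy; rewrite between_diags_upper//.
  have eqD q : (q < len t)%N -> D t w q = D t y q.
    by move=> ql; apply: off; rewrite // ?ltn_eqF// ltnW.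
  rewrite (@eq_between_diags S t y w)//; [|exact: ltnW|]; last first.
    move=> u p /andP[su ut] pu; apply: off; rewrite // ?ltn_eqF//.
    by rewrite (leq_trans ut)// ltnW.
  split=> -[Q1 Q2]; split=> // p ps; have := Q2 p ps; rewrite /upper_box;
    by rewrite !(eq_upper_point eqD).
- move=> [Q1 _]; apply: upper_point_nondec => // p pl.
  by apply: Q1; rewrite ?leqnn ?andbT.
- move=> w wy; rewrite (IHC S h) ?mS ?leqW// (hS y w)// => p pS.
  by apply: off; rewrite // ?ltn_eqF// (leq_trans St)// ltnW.
Qed.

End diagonal_integration.

(** * Increasing arrays described by diagonals, and their measurability *)

Section increasing_arrays_diagonals.
Context (R : realType).
Variables m n : nat.
Hypotheses (m_gt0 : (0 < m)%N) (ltmn : (m < n)%N).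

Local Notation len := (diag_len m n).
Local Notation top := (last_diag m n).
Local Notation D := (@diag_entry R m n).
Implicit Types (y w : (m * n).-tuple R) (s t u p i j : nat).

Lemma diag_entryE t y p i j : (diag_row m t + p = i)%N -> (diag_col m t + p = j)%N ->
  D t y p = array_entry y i.+1 j.+1.
Proof. by move=> <- <-. Qed.

(** A diagonal starts in the first row or the first column, so a cell has position [minn i j] on
    it. *)
Lemma diag_entry_cell i j : (i < m)%N -> (j < n)%N ->
  let t := (m.-1 - i + j)%N in
  [/\ (t <= top)%N, (minn i j < len t)%N,
      (diag_row m t + minn i j = i)%N & (diag_col m t + minn i j = j)%N].
Proof.
by move=> im jn t; rewrite /diag_len /diag_row /diag_col /last_diag /t; split; lia.
Qed.

(** The neighbours [(i - 1, j)] and [(i, j + 1)] of a cell both lie on the next diagonal and are the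
    left and right ends of its box. *)
Lemma increasing_arraysE y : increasing_arrays y <-> between_diags 0 top y.
Proof.
split=> [Y|[Q1 Q2] [//|i] [//|j] /= im jn].
  split=> u p /= uT pu.
    have [im jn] := diag_cell_bounds m_gt0 ltmn uT pu.
    by rewrite (diag_entryE _ erefl erefl); case: (Y (diag_row m u + p).+1 (diag_col m u + p).+1).
  have [im jn] := diag_cell_bounds m_gt0 ltmn (ltnW uT) pu.
  have [/andP[y0 y1] yr yd] := Y (diag_row m u + p).+1 (diag_col m u + p).+1 im jn.
  rewrite (diag_entryE _ erefl erefl) itv_boundlr /= /lower_left_closed /lower_right_open.
  rewrite /lower_point; have [um|mu] := ltnP u m.-1.
    have lu : (p.+1 < len u.+1)%N by rewrite diag_len_grow.
    have [im' jn'] := diag_cell_bounds m_gt0 ltmn uT lu.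
    have dr : (diag_row m u.+1).+1 = diag_row m u by rewrite /diag_row; lia.
    have dc : diag_col m u.+1 = diag_col m u by rewrite /diag_col; lia.
    rewrite !bnd_simp; apply/andP; split.
      rewrite (@diag_entryE _ _ _ (diag_row m u + p).-1 (diag_col m u + p)); [|lia|lia].
      have im1 : (0 < (diag_row m u + p).-1.+1 <= m)%N by lia.
      have [_ _] := Y (diag_row m u + p).-1.+1 (diag_col m u + p).+1 im1 jn.
      by rewrite (_ : (diag_row m u + p).-1.+1 = (diag_row m u + p)%N); [apply|]; lia.
    rewrite (@diag_entryE _ _ _ (diag_row m u + p) (diag_col m u + p).+1); [|lia|lia].
    by apply: yr; lia.
  have dr : diag_row m u.+1 = diag_row m u by rewrite /diag_row; lia.
  have dc : diag_col m u.+1 = (diag_col m u).+1 by rewrite /diag_col; lia.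
  apply/andP; split.
    case: p pu im jn y0 y1 yr yd => [|p] pu im jn y0 y1 yr yd /=; first by rewrite bnd_simp.
    have /andP[l1 l2] := diag_len_bounds m_gt0 ltmn uT mu.
    have pl : (p < len u.+1)%N by rewrite -ltnS (leq_trans pu).
    rewrite pl bnd_simp.
    rewrite (@diag_entryE _ _ _ (diag_row m u + p) (diag_col m u + p).+1); [|lia|lia].
    have [_ _] := Y (diag_row m u + p).+1 (diag_col m u + p).+2 ltac:(lia) ltac:(lia).
    by rewrite !addnS; apply; lia.
  case: ifP => pl; rewrite bnd_simp//.
  have [im' jn'] := diag_cell_bounds m_gt0 ltmn uT pl.
  rewrite (@diag_entryE _ _ _ (diag_row m u + p) (diag_col m u + p).+1); [|lia|lia].
  by apply: yr; lia.
have [tT pt ri cj] := diag_entry_cell im jn.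
set t := (m.-1 - i + j)%N in tT pt ri cj; set p := minn i j in pt ri cj.
have yE := diag_entryE y ri cj; split; first by rewrite -yE; exact: Q1.
- move=> j1n; have [tT' pt' ri' cj'] := diag_entry_cell im j1n.
  have tt : (m.-1 - i + j.+1 = t.+1)%N by rewrite /t; lia.
  rewrite tt in tT' pt' ri' cj'.
  have := Q2 t p tT' pt; rewrite itv_boundlr => /andP[_].
  rewrite /lower_right_open /lower_point -yE; case: ltnP => tm /=.
    rewrite bnd_simp (@diag_entryE t.+1 y p.+1 i j.+1)//; move: ri cj ri' cj'.
      by rewrite /diag_row; lia.
    by rewrite /diag_col; lia.
  have -> : (p < len t.+1)%N.
    apply: leq_trans pt'; rewrite ltnS.
    by move: ri cj ri' cj'; rewrite /diag_row /diag_col; lia.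
  rewrite bnd_simp (@diag_entryE t.+1 y p i j.+1)//; move: ri cj ri' cj'.
    by rewrite /diag_row; lia.
  by rewrite /diag_col; lia.
- move=> i1m; have [tT' pt' ri' cj'] := diag_entry_cell i1m jn.
  have tt : t = (m.-1 - i.+1 + j).+1%N by rewrite /t; lia.
  set u := (m.-1 - i.+1 + j)%N in tt tT' pt' ri' cj'.
  rewrite tt in tT pt ri cj yE.
  have := Q2 u _ tT pt'; rewrite itv_boundlr => /andP[+ _].
  rewrite (diag_entryE y ri' cj') /lower_left_closed /lower_point; case: ltnP => um /=.
    rewrite bnd_simp (@diag_entryE u.+1 y (minn i.+1 j) i j)//; move: ri cj ri' cj'.
      by rewrite /diag_row; lia.
    by rewrite /diag_col; lia.
  have -> : minn i.+1 j = p.+1.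
    by move: ri cj ri' cj'; rewrite /p /diag_row /diag_col; lia.
  by rewrite pt bnd_simp -yE.
Qed.

Lemma measurable_increasing_arrays : measurable (@increasing_arrays R m n).
Proof.
rewrite (_ : @increasing_arrays R m n = \bigcap_i \bigcap_j
  [set y : (m * n).-tuple R | (1 <= i <= m)%N -> (1 <= j <= n)%N ->
    [/\ 0 <= array_entry y i j <= 1,
        ((j < n)%N -> array_entry y i j < array_entry y i j.+1) &
        ((i < m)%N -> array_entry y i j < array_entry y i.+1 j)]]); last first.
  apply/seteqP; split=> y Y; first by move=> i _ j _; exact: Y.
  by move=> i j; exact: (Y i I j I).
apply: bigcapT_measurable => i; apply: bigcapT_measurable => j.
have me i' j' := @measurable_array_entry R m n i' j'.
have mle i1 j1 i2 j2 : measurable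
    [set y : (m * n).-tuple R | array_entry y i1 j1 < array_entry y i2 j2].
  have := measurable_fun_ltr (me i1 j1) (me i2 j2) measurableT (Y := [set true]) I.
  by rewrite setTI.
have [im|im] := boolP (1 <= i <= m)%N; last first.
  by rewrite (_ : mkset _ = setT)//; apply/seteqP; split=> // y _; rewrite /= (negPf im).
have [jn|jn] := boolP (1 <= j <= n)%N; last first.
  by rewrite (_ : mkset _ = setT)//; apply/seteqP; split=> // y _; rewrite /= (negPf jn).
rewrite (_ : mkset _ = ([set y | array_entry y i j \in `[0, 1]] `&`
  [set y | (j < n)%N -> array_entry y i j < array_entry y i j.+1]) `&`
  [set y | (i < m)%N -> array_entry y i j < array_entry y i.+1 j]); last first.
  apply/seteqP; split=> y /=; rewrite in_itv/=; first by case/(_ isT isT).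
  by move=> [[? ?] ?] _ _.
apply: measurableI; first apply: measurableI.
- rewrite -[X in measurable X]setTI.
  by apply: (me i j measurableT `[0, 1]%classic); exact: measurable_itv.
- case: (ltnP j n) => _; first by rewrite (_ : mkset _ = [set y | array_entry y i j < array_entry y i j.+1])//; apply/seteqP; split=> y //=; apply.
  by rewrite (_ : mkset _ = setT)//; apply/seteqP; split.
- case: (ltnP i m) => _; first by rewrite (_ : mkset _ = [set y | array_entry y i j < array_entry y i.+1 j])//; apply/seteqP; split=> y //=; apply.
  by rewrite (_ : mkset _ = setT)//; apply/seteqP; split.
Qed.

End increasing_arrays_diagonals.

(** * The marginal density *)

Section jacobi_weight_facts.
Context (R : realType).
Variable k : nat.
Implicit Types x : k.-tuple R.

(** The determinant is the product of the opposite differences; squaring removes the signs. *)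
Lemma vandermonde_sqr x : vandermonde x ^+ 2 =
  (\det (\matrix_(i < k, j < k) (x`_j ^+ i))) ^+ 2.
Proof.
have -> : \matrix_(i < k, j < k) (x`_j ^+ i) = Vandermonde k (\row_j x`_j).
  by apply/matrixP => i j; rewrite !mxE.
rewrite det_Vandermonde /vandermonde -!prodrXl; apply: eq_bigr => i _.
rewrite -!prodrXl; apply: eq_bigr => j _.
by rewrite -sqrrN opprB !(tnth_nth 0) !mxE.
Qed.

Lemma sorted_nondec x : sorted <=%R x = `[< nondec k (fun p => x`_p) >].
Proof.
apply/idP/asboolP => [/(sortedP 0) xs p pk|xs].
  by apply: xs; rewrite size_tuple.
by apply/(sortedP 0) => p; rewrite size_tuple => pk; apply: xs.
Qed.

(** One determinant for each side of the diagonal; [b1] comes from below and [b2] from above. *)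
Lemma jacobi_weightE a b1 b2 x : jacobi_weight a (b1 + b2) x =
  `[< nondec k (fun p => x`_p) >]%:R *
  (jacobi_det k a b1 (fun p => x`_p) * jacobi_det k 0 b2 (fun p => x`_p)).
Proof.
rewrite /jacobi_weight sorted_nondec vandermonde_sqr /jacobi_det -mulrA; congr (_ * _).
rewrite mulrACA -expr2 -big_split; congr (_ * _); apply: eq_bigr => i _.
by rewrite (tnth_nth 0) /= expr0 mul1r exprD mulrA.
Qed.

Lemma jacobi_weight_ge0 a b x : unit_cube x -> 0 <= jacobi_weight a b x.
Proof.
move=> x01; rewrite /jacobi_weight mulr_ge0 ?prodr_ge0//.
  by rewrite mulr_ge0 ?sqr_ge0.
move=> i _; have /andP[x0 x1] := x01 i.
by rewrite mulr_ge0 ?exprn_ge0 ?subr_ge0.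
Qed.

Lemma measurable_nth_tuple p : measurable_fun setT (fun x : k.-tuple R => x`_p).
Proof.
have [pk|pk] := ltnP p k.
  rewrite (_ : (fun x : k.-tuple R => x`_p) = (fun x => tnth x (Ordinal pk))).
    exact: measurable_tnth.
  by apply/funext => x; rewrite (tnth_nth 0).
rewrite (_ : (fun x : k.-tuple R => x`_p) = cst 0); first exact: measurable_cst.
by apply/funext => x; rewrite nth_default ?size_tuple.
Qed.

Lemma measurable_nondec : measurable [set x : k.-tuple R | nondec k (fun p => x`_p)].
Proof.
rewrite (_ : mkset _ = \bigcap_p [set x : k.-tuple R | (p.+1 < k)%N -> x`_p <= x`_p.+1]).
  apply: bigcapT_measurable => p; have [pk|pk] := ltnP p.+1 k.
    have := measurable_fun_ler (measurable_nth_tuple p)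
      (measurable_nth_tuple p.+1) measurableT (Y := [set true]) I.
    rewrite setTI; congr measurable; apply/seteqP; split=> x /=; last exact.
    by move=> + _.
  by rewrite (_ : mkset _ = setT)//; apply/seteqP; split.
by apply/seteqP; split=> x xs p; [move=> _; apply: xs|apply: (xs p)].
Qed.

Lemma measurable_jacobi_weight a b :
  measurable_fun setT (@jacobi_weight R k a b).
Proof.
have mt (i : 'I_k) : measurable_fun setT (fun x => tnth x i).
  exact: measurable_tnth.
apply: measurable_funM; first apply: measurable_funM.
- rewrite (_ : (fun x => _) = \1_[set x : k.-tuple R | nondec k (fun p => x`_p)]).
    by apply: measurable_indic; exact: measurable_nondec.
  by apply/funext => x; rewrite indicE sorted_nondec.
- apply: measurable_funX; apply: measurable_prod => i _.
  rewrite (_ : (fun x => _) =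
    fun x => \prod_(j < k) if (i < j)%N then tnth x i - tnth x j else 1).
    apply: measurable_prod => j _; case: (i < j)%N; last exact: measurable_cst.
    exact: measurable_funB.
  by apply/funext => x; rewrite big_mkcond.
- apply: measurable_prod => i _; apply: measurable_funM.
    exact: measurable_funX.
  apply: measurable_funX; apply: measurable_funB => //; exact: measurable_cst.
Qed.

Lemma measurable_unit_cube : measurable (@unit_cube R k).
Proof.
rewrite (_ : @unit_cube R k = \bigcap_(i in [set: 'I_k])
    ((fun x : k.-tuple R => tnth x i) @^-1` `[0, 1]%classic)).
  apply: fin_bigcap_measurable => // i _.
  rewrite -[X in measurable X]setTI.
  exact: (measurable_tnth i measurableT (measurable_itv `[0, 1])).
apply/seteqP; split=> x xs i; last by have := xs i I; rewrite /= in_itv.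
by move=> _; have := xs i; rewrite /= in_itv.
Qed.

End jacobi_weight_facts.

(** * The law of a diagonal and its normalization *)

Section marginal.
Context (R : realType).
Variables m n : nat.
Hypotheses (m_gt0 : (0 < m)%N) (ltmn : (m < n)%N).

Local Notation len := (diag_len m n).
Local Notation top := (last_diag m n).
Local Notation D := (@diag_entry R m n).
Implicit Types (y w : (m * n).-tuple R).

Section diagonal_tuple_facts.
Variable s : nat.
Hypotheses (ms : (m.-1 <= s)%N) (sT : (s <= top)%N).
Local Notation diag := (@diagonal_tuple R m n (len s) (s - m.-1)).

Lemma nth_diagonal_tuple y p : (p < len s)%N -> (diag y)`_p = D s y p.
Proof.
move=> pl; rewrite -(tnth_nth 0 _ (Ordinal pl)) tnth_mktuple.
rewrite (@diag_entryE _ _ _ _ _ _ p (s - m.-1 + p))//=.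
  by rewrite addnS.
by rewrite /diag_row; lia.
Qed.

Lemma diagonal_tuple_cells y :
  [tuple y`_(nth 0%N (diag_cells m n s) i) | i < len s] = diag y.
Proof.
apply: eq_from_tnth => i; rewrite tnth_mktuple [RHS](tnth_nth 0).
by rewrite nth_diagonal_tuple// nth_mkseq.
Qed.

Lemma diagonal_tuple_surj (x : (len s).-tuple R) : exists y, diag y = x.
Proof.
(* Off the diagonal [index] is out of range, which yields the default entry 0. *)
exists [tuple x`_(index (val i) (diag_cells m n s)) | i < m * n].
apply: eq_nth_tuple => p pl; rewrite nth_diagonal_tuple// /diag_entry.
have cN : (diag_cell m n s p < m * n)%N by exact: diag_cell_lt.
rewrite -(tnth_nth 0 _ (Ordinal cN)) tnth_mktuple /=; congr (nth 0 _ _).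
have -> : diag_cell m n s p = nth 0%N (diag_cells m n s) p by rewrite nth_mkseq.
by rewrite index_uniq ?size_mkseq// uniq_diag_cells.
Qed.

Lemma between_diags_unit_cube y : between_diags s s y <-> unit_cube (diag y).
Proof.
split=> [[Q _] i|Q].
  by rewrite (tnth_nth 0) nth_diagonal_tuple//; apply: Q; rewrite ?leqnn.
split=> u p; last by case/andP => su us; have := leq_ltn_trans su us; rewrite ltnn.
rewrite -eqn_leq => /eqP <- pl.
by have := Q (Ordinal pl); rewrite (tnth_nth 0) nth_diagonal_tuple.
Qed.

Lemma measure_diagonal_tuple : exists C : R,
  forall A : set ((len s).-tuple R), measurable A ->
    let g x := (C * \1_A x * \1_(@unit_cube R (len s)) x *
       jacobi_weight (low_a m s) (low_b n s + up_b n s) x)%:E in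
    (forall x, 0 <= g x)%E /\
    lebesgue_tuple (diag @^-1` A `&` @increasing_arrays R m n) =
      (\int[@lebesgue_tuple R (len s)]_x g x)%E.
Proof.
have [C1 HC1] := @iint_lower_cells R m n m_gt0 ltmn s sT.
have [C2 HC2] := @iint_upper_cells R m n m_gt0 ltmn (top - s)%N ltac:(lia).
rewrite subKn// in HC2.
exists (C1 * C2) => A mA g.
set B := _ `&` _.
have mB : measurable B.
  apply: measurableI; last exact: measurable_increasing_arrays.
  rewrite -[X in measurable X]setTI.
  exact: (@measurable_diagonal_tuple R m n (len s) (s - m.-1) measurableT).
have on_eq y w : (forall p, (p < len s)%N -> D s w p = D s y p) -> diag w = diag y.
  by move=> wy; apply: eq_nth_tuple => p pl; rewrite !nth_diagonal_tuple// wy.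
pose f w := (\1_B w : R)%:E.
(* With diagonal [s] fixed, the lower cells are integrated first, then the upper ones; [h'] is the
   outcome of the first stage and depends on diagonal [s] only. *)
have inner w : iint (upper_cells m n (top - s) ++ lower_cells m n s) f w = g (diag w).
  pose h w := \1_A (diag w) : R.
  have hs : on_diag s h by move=> y v yv; rewrite /h (on_eq _ _ yv).
  pose h' w := C1 * h w * `[< nondec (len s) (D s w) >]%:R *
    jacobi_det (len s) (low_a m s) (low_b n s) (D s w).
  have hs' : on_diag s h'.
    move=> y v yv; rewrite /h' (hs _ _ yv) (eq_jacobi_det _ _ yv).
    congr (_ * _%:R * _); congr nat_of_bool; apply: asbool_equiv_eq.
    by rewrite /nondec; split=> inc p pl; have := inc p pl;
      rewrite !yv// ltnW.
  have -> : f = (fun w => (h w * `[< between_diags 0 top w >]%:R)%:E).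
    apply/funext => v; rewrite /f /h !indicE /B in_setI -natrM mulnb.
    congr ((nat_of_bool _)%:R)%:E; congr (_ && _).
    apply/idP/asboolP; rewrite in_setE.
      by move/(increasing_arraysE m_gt0 ltmn).
    by move=> ?; apply/(increasing_arraysE m_gt0 ltmn).
  rewrite iint_cat.
  have -> : iint (lower_cells m n s) (fun w => (h w * `[< between_diags 0 top w >]%:R)%:E)
      = (fun w => (h' w * `[< between_diags s top w >]%:R)%:E).
    apply/funext => v; rewrite (HC1 s)// ?leqnn//; congr EFin.
    by rewrite /h'; ring.
  rewrite (HC2 s)// ?ms ?leqnn// /g jacobi_weightE; congr EFin.
  have eqD p : (p < len s)%N -> (diag w)`_p = D s w p by exact: nth_diagonal_tuple.
  rewrite !(eq_jacobi_det _ _ eqD) /h' /h.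
  have -> : `[< nondec (len s) (fun p => (diag w)`_p) >] = `[< nondec (len s) (D s w) >].
    apply: asbool_equiv_eq.
    by split=> inc p pl; have := inc p pl; rewrite !eqD// ltnW.
  have -> : `[< between_diags s s w >]%:R = \1_(@unit_cube R (len s)) (diag w) :> R.
    rewrite indicE; congr (_ %:R); congr nat_of_bool.
    by apply/asboolP/idP; rewrite in_setE => /between_diags_unit_cube.
  (* Each side produces the ordering indicator, which is idempotent. *)
  by case: (`[< nondec _ _ >]); rewrite ?mulr0 ?mul0r ?mulr1 ?mul1r//; ring.
(* The sign of [C] is unknown, so nonnegativity comes from writing [g x] as an integral of an
   indicator, for an array with diagonal [x]. *)
have g0 x : (0 <= g x)%E.
  have [w <-] := diagonal_tuple_surj x; rewrite -inner; apply: iint_ge0 => z.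
  by rewrite lee_fin.
split=> //.
pose y0 : (m * n).-tuple R := [tuple 0 | i < m * n].
have mf : measurable_fun [set: (m * n).-tuple R] f.
  by apply/measurable_EFinP; exact: measurable_indic.
rewrite (lebesgue_tuple_iint y0 mB) (perm_iint _ mf _ (perm_cells m_gt0 ltmn sT)); last first.
  by move=> z; rewrite lee_fin.
rewrite iint_cat (_ : iint _ f = fun w => g (diag w)); last exact/funext.
rewrite -(@iint_lebesgue_tuple R (m * n) (len s) (diag_cells m n s) g y0) ?size_mkseq//.
- by congr iint; apply/funext => w; rewrite diagonal_tuple_cells.
- exact: uniq_diag_cells.
- by apply/allP => l; rewrite mem_diag_cells// => /andP[].
- apply/measurable_EFinP; apply: measurable_funM; last exact: measurable_jacobi_weight.
  apply: measurable_funM; last by apply: measurable_indic; exact: measurable_unit_cube.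
  by apply: measurable_funM; [exact: measurable_cst|exact: measurable_indic].
Qed.

Lemma marginal_density (d : measure_display) (T : measurableType d)
    (P : probability T R) (Y : {RV P >-> (m * n).-tuple R}) :
  uniform_on Y (@increasing_arrays R m n) ->
  has_density_propto_on (diag \o Y : {RV P >-> (len s).-tuple R})
    (@unit_cube R (len s)) (@jacobi_weight R (len s) (low_a m s) (low_b n s + up_b n s)).
Proof.
move=> unifY; have [C HC] := measure_diagonal_tuple.
set jw := jacobi_weight _ _ in HC *.
pose I := @increasing_arrays R m n.
(* Total probability 1 forces this quotient to be 1, which excludes volume 0 and infinite volume,
   where it would be 0. *)
have vol1 : (lebesgue_tuple I / lebesgue_tuple I = 1)%E.
  have := unifY setT measurableT; rewrite setTI => <-.
  by rewrite /distribution /pushforward preimage_setT probability_setT.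
have vol_ge0 : (0 <= lebesgue_tuple I)%E by exact: measure_ge0.
have [vol vol_gt0 volE] : exists2 v : R, 0 < v & lebesgue_tuple I = v%:E.
  move: vol1 vol_ge0; case: (lebesgue_tuple I) => [v| |]//=.
    rewrite lee_fin le_eqVlt => v1 /predU1P[v0|v0]; last by exists v.
    by move: v1; rewrite -v0 mul0e => /esym/eqP; rewrite onee_eq0.
  by rewrite invey mule0 => /esym/eqP; rewrite onee_eq0.
(* If [C <= 0], the integrand would be both nonpositive and nonnegative, so the volume would be
   0. *)
have C_gt0 : 0 < C.
  rewrite ltNge; apply/negP => C0.
  have [g0] := HC setT measurableT; rewrite preimage_setT setTI -/I volE.
  rewrite integral0_eq => [/eqP|x _]; first by rewrite eqe gt_eqF.
  apply/eqP; rewrite eq_le g0 andbT lee_fin !indicE in_setT mulr1.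
  have [xc|xc] := boolP (x \in @unit_cube R (len s)); last by rewrite mulr0 mul0r.
  by rewrite mulr1 mulr_le0_ge0// jacobi_weight_ge0//; move: xc; rewrite in_setE.
exists (C / vol); first exact: divr_gt0.
split.
- apply: measurable_funM; first exact: measurable_cst.
  by apply: measurable_funTS; exact: measurable_jacobi_weight.
- move=> x xc; apply: mulr_ge0; last exact: jacobi_weight_ge0.
  by rewrite ltW// divr_gt0.
move=> A mA; have [g0 HA] := HC A mA.
transitivity (lebesgue_tuple (diag @^-1` A `&` I) / lebesgue_tuple I)%E.
  rewrite -unifY//; rewrite -[X in measurable X]setTI.
  exact: (@measurable_diagonal_tuple R m n (len s) (s - m.-1) measurableT).
rewrite HA volE inver gt_eqF//= muleC -ge0_integralZl//; last first.
- by rewrite lee_fin invr_ge0 ltW.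
- apply/measurable_EFinP; apply: measurable_funM; last exact: measurable_jacobi_weight.
  apply: measurable_funM; last by apply: measurable_indic; exact: measurable_unit_cube.
  by apply: measurable_funM; [exact: measurable_cst|exact: measurable_indic].
rewrite [RHS]integral_mkcond; apply: eq_integral => x _.
rewrite patchE in_setI !indicE -EFinM.
case: (x \in A); case: (x \in @unit_cube R (len s)) => /=; rewrite ?mulr0 ?mul0r ?mulr0// !mulr1.
by congr EFin; rewrite mulrA (mulrC vol^-1).
Qed.

End diagonal_tuple_facts.
End marginal.

Theorem theorem4 (R : realType) (m n : nat)
  (d : measure_display) (T : measurableType d) (P : probability T R)
  (Y : {RV P >-> (m * n).-tuple R}) :
  (0 < m)%N -> (m < n)%N ->
  uniform_on Y (@increasing_arrays R m n) ->
  (forall k : nat, (1 <= k <= m)%N ->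
     has_density_propto_on (@diagonal_tuple R m n k (n - k) \o Y : {RV P >-> k.-tuple R})
       (@unit_cube R k) (@jacobi_weight R k (n - k) (m - k))) /\
  (forall k : nat, (m < k <= n)%N ->
     has_density_propto_on (@diagonal_tuple R m n m (n - k) \o Y : {RV P >-> m.-tuple R})
       (@unit_cube R m) (@jacobi_weight R m (n - k) (k - m))).
Proof.
move=> m0 mn unifY.
(* The index of the diagonal that starts at the cell [(1, n - k + 1)]. *)
pose s k := (m.-1 + (n - k))%N.
have sP k : (1 <= k <= n)%N -> (m.-1 <= s k)%N /\ (s k <= last_diag m n)%N.
  by rewrite /s /last_diag; lia.
have lenE k : (1 <= k <= n)%N -> diag_len m n (s k) = minn k m.
  by rewrite /s /diag_len /diag_row /diag_col; lia.
have aE k : low_a m (s k) = (n - k)%N by rewrite /low_a /s; lia.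
(* By truncated subtraction at least one of the terms is 0, so one formula serves both ranges of
   [k]. *)
have bE k : (1 <= k <= n)%N ->
    (low_b n (s k) + up_b n (s k) = (m - k) + (k - m))%N.
  by rewrite /low_b /up_b /s; lia.
have cE k : (s k - m.-1 = n - k)%N by rewrite /s; lia.
split=> k kb; have kn : (1 <= k <= n)%N by lia.
  have [ms sT] := sP k kn; have := marginal_density m0 mn ms sT unifY.
  rewrite aE bE// cE lenE// (_ : minn k m = k); last lia.
  by rewrite (_ : (m - k + (k - m) = m - k)%N); last lia.
have [ms sT] := sP k kn; have := marginal_density m0 mn ms sT unifY.
rewrite aE bE// cE lenE// (_ : minn k m = m); last lia.
by rewrite (_ : (m - k + (k - m) = k - m)%N); last lia.
Qed.
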